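(* In a finger B-tree with aggregates (with $\mu$ treated as a constant and each $\otimes$ costing constant time), query$()$ costs $O(1)$ time, and insert$(t,v)$ and evict$(t)$ take time $T_{\mathrm{search}}+T_{\mathrm{rebalance}}+T_{\mathrm{repair}}$, where $T_{\mathrm{search}}$ is $O(\log d)$ with $d$ being the distance (number of stored entries) from the position of $t$ to the start or end of the window, whichever is closer; $T_{\mathrm{rebalance}}$ is amortized $O(1)$ and worst-case $O(\log n)$, $n$ being the window size; and $T_{\mathrm{repair}}$ is $O(T_{\mathrm{search}}+T_{\mathrm{rebalance}})$.
   Context: A monoid is $(S,\otimes,\mathbf{1})$ with $\otimes$ associative and identity $\mathbf{1}$. A finger B-tree with aggregates with parameter $\mu\ge2$ is a search tree keyed by timestamps: each node of arity $a$ stores $a-1$ time-ordered pairs $\langle t_0,v_0\rangle,\dots,\langle t_{a-2},v_{a-2}\rangle$ and, if non-leaf, children $z_0,\dots,z_{a-1}$ with timestamps of the subtree of $z_j$ between $t_{j-1}$ and $t_j$; all leaves at the same depth; non-root nodes have $\mu\le a\le 2\mu$, the root $2\le a\le 2\mu$; nodes have parent pointers and there are fingers to the leftmost and rightmost leaves; the left (right) spine is the path from the root to the left (right) finger. Each node stores a partial aggregate: non-spine nodes store $\Pi_\uparrow(y)=\Pi_\uparrow(z_0)\otimes v_0\otimes\cdots\otimes v_{a-2}\otimes\Pi_\uparrow(z_{a-1})$ (the aggregate of its subtree); the root stores the aggregate of its own values and of all its children's subtrees except the leftmost and rightmost ones (just its values if it is a leaf); a non-root node $y$ on the left spine stores the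 aggregate of all entries in the subtree of the root's leftmost child except those in the subtree of $y$'s leftmost child; symmetrically for the right spine. query$()$ returns the root's aggregate if the root is a leaf, else left-finger aggregate $\otimes$ root aggregate $\otimes$ right-finger aggregate. insert$(t,v)$ (combine $v_i\otimes v$ if $t=t_i$ exists, else insert the pair) and evict$(t)$ (remove the pair with time $t$ if present) proceed by: (1) searching for the node where $t$ belongs, starting at the nearer finger, walking up parent pointers to the lowest ancestor whose subtree covers $t$, then down to the node; (2) locally inserting/evicting there (evicting from a non-leaf node is done by removing a substitute entry from a leaf—the oldest entry of the right child's subtree if that child has arity $>\mu$, else the youngest entry of the left child's subtree—and writing it into the evicted slot); (3) rebalancing after the fact, bottom-up: while a node has arity $>2\mu$ split it (increasing the height first if it is the root), and while a non-root node has arity $<\mu$ merge it with a sibling of arity $\le\mu$ (decreasing the height if the root is left with arity 1) or else move one child and one pair from the sibling; (4) repairing the partial aggregates of the nodes that are affected, i.e., those on the search path or involved in rebalancing and, when a spine is affected, the nodes of that spine down to its finger. *)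

(* Defs.v *)
From HB Require Import structures.
From mathcomp Require Import all_boot all_order.

Set Implicit Arguments.
Unset Strict Implicit.
Unset Printing Implicit Defensive.

(* Cost model.  A computation is a pair of a trace and a result; the trace has
   one item per elementary step, labelled by the phase the step belongs to.
   Elementary steps are: following a pointer, comparing two timestamps, one
   application of the monoid operation, and moving one entry or one child
   pointer inside or between nodes. *)

Inductive phase := Search | Rebalance | Repair | Query.

Definition phase_eq_dec : comparable phase.
Proof. by move=> a b; rewrite /decidable; decide equality. Defined.
HB.instance Definition _ := hasDecEq.Build phase (compareP phase_eq_dec).

Definition run (A : Type) : Type := (seq phase * A)%type.

Definition ret {A} (a : A) : run A := ([::], a).
Definition bind {A B} (m : run A) (k : A -> run B) : run B :=
  let r := k m.2 in (m.1 ++ r.1, r.2).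
Definition tick (ph : phase) (n : nat) : run unit := (nseq n ph, tt).

Notation "'let*' p ':=' m 'in' k" := (bind m (fun p => k))
  (at level 200, p pattern, m at level 100, k at level 200).

Definition trace {A} (m : run A) : seq phase := m.1.
Definition time {A} (m : run A) : nat := size (trace m).
Definition time_in {A} (ph : phase) (m : run A) : nat :=
  count (pred1 ph) (trace m).

(* A node holds its partial aggregate, its time-ordered pairs and its
   children; a leaf has no children. *)
Inductive tree (T S : Type) := Node of S & seq (T * S) & seq (tree T S).

(* Node addresses play the role of pointers.  They are read from the node up
   to the root: [::] is the root and i :: p is the i-th child of the node p, so
   that the parent pointer of i :: p is p.  Dereferencing an address is an
   elementary step, whatever its length. *)
Definition addr := seq nat.

Inductive update (T S : Type) := Insert of T & S | Evict of T.

Section FingerBTree.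

Context {disp : Order.disp_t} {T : orderType disp} {S : Type} {e : S}.
Context (op : Monoid.law e) (mu : nat).

(* pick w i tells whether the i-th child of w, when it underflows and has two
   adjacent siblings, is rebalanced with the left one. *)
Context (pick : tree T S -> nat -> bool).

Implicit Types (t y : tree T S) (p q : addr) (tm : T) (v : S).

Definition agg y := let: Node a _ _ := y in a.
Definition ents y := let: Node _ es _ := y in es.
Definition kids y := let: Node _ _ zs := y in zs.
Definition arity y := (size (ents y)).+1.
Definition is_leaf y := nilp (kids y).
Definition empty : tree T S := Node e [::] [::].

(* Bounds the number of entries and child pointers of a node; this is what a
   local operation on the node is charged. *)
Definition width y := (size (ents y) + size (kids y)).+1.

Definition with_agg a y := Node a (ents y) (kids y).
Definition with_ents es y := Node (agg y) es (kids y).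

Fixpoint node_at t p :=
  if p is i :: q then nth empty (kids (node_at t q)) i else t.

Fixpoint valid t p :=
  if p is i :: q then valid t q && (i < size (kids (node_at t q))) else true.

Fixpoint modify t p (f : tree T S -> tree T S) :=
  if p is i :: q then
    modify t q (fun y => Node (agg y) (ents y)
      (set_nth empty (kids y) i (f (nth empty (kids y) i))))
  else f t.

(* z_0 ++ x_0 :: z_1 ++ x_1 :: ... ++ z_(a-1); just the x's for a leaf. *)
Fixpoint weave {A : Type} (zs : seq (seq A)) (xs : seq A) : seq A :=
  match zs, xs with
  | [::], _ => xs
  | z :: _, [::] => z
  | z :: zs', x :: xs' => z ++ x :: weave zs' xs'
  end.

Fixpoint entries y : seq (T * S) :=
  let: Node _ es zs := y in weave [seq entries z | z <- zs] es.

Definition times y : seq T := [seq x.1 | x <- entries y].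
Definition values y : seq S := [seq x.2 | x <- entries y].

Definition fold (s : seq S) : S := foldr op e s.

(* The node's own values interleaved with the terms f z of its children z,
   without the leftmost child if skipl and the rightmost child if skipr. *)
Definition node_terms (f : tree T S -> seq S) (skipl skipr : bool) y : seq S :=
  weave [seq if skipl && (i == 0) || skipr && (i.+1 == size (kids y))
             then [::] else f (nth empty (kids y) i)
        | i <- iota 0 (size (kids y))]
        [seq x.2 | x <- ents y].

(* Spine membership of non-root nodes.  Nodes carry these flags, so testing
   them is not charged. *)
Definition on_left p := ~~ nilp p && all (pred1 0) p.

Fixpoint all_last t p :=
  if p is i :: q then (i.+1 == size (kids (node_at t q))) && all_last t q
  else true.
Definition on_right t p := ~~ nilp p && all_last t p.

Definition on_spine t p := [|| nilp p, on_left p | on_right t p].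

Fixpoint height y := if y is Node _ _ (z :: _) then (height z).+1 else 0.

Fixpoint last_path y : seq nat :=
  let: Node _ _ zs := y in
  if nilp zs then [::]
  else (size zs).-1 :: last [::] [seq last_path z | z <- zs].

Definition left_finger t : addr := nseq (height t) 0.
Definition right_finger t : addr := rev (last_path t).

Fixpoint up_agg y : S :=
  let: Node _ es zs := y in
  fold (weave [seq [:: up_agg z] | z <- zs] [seq x.2 | x <- es]).

Definition first_kid_times y := if kids y is z :: _ then times z else [::].
Definition last_kid_times y :=
  if kids y is z :: zs then times (last z zs) else [::].

Definition partial_agg t p : S :=
  let y := node_at t p in
  if nilp p then fold (node_terms values true true y)
  else if on_left p then
    fold [seq x.2 | x <- entries (node_at t [:: 0])
                  & x.1 \notin first_kid_times y]
  else if on_right t p then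
    fold [seq x.2 | x <- entries (node_at t [:: (size (kids t)).-1])
                  & x.1 \notin last_kid_times y]
  else up_agg y.

(* The empty window is a root without entries nor children; it is the only
   exception to the lower bound 2 on the arity of the root. *)
Record finger_btree t : Prop := FingerBTree {
  root_arity : (2 <= arity t <= mu.*2) \/ (ents t = [::] /\ kids t = [::]);
  node_arity : forall p, valid t p -> ~~ nilp p ->
    mu <= arity (node_at t p) <= mu.*2;
  node_kids : forall p, valid t p -> ~~ is_leaf (node_at t p) ->
    size (kids (node_at t p)) = arity (node_at t p);
  leaf_depth : forall p q, valid t p -> valid t q ->
    is_leaf (node_at t p) -> is_leaf (node_at t q) -> size p = size q;
  ents_sorted : forall p, valid t p ->
    sorted <%O [seq x.1 | x <- ents (node_at t p)];
  kids_between : forall p i tm, valid t (i :: p) ->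
    tm \in times (node_at t (i :: p)) ->
    let ts := [seq x.1 | x <- ents (node_at t p)] in
    (0 < i -> (nth tm ts i.-1 < tm)%O) /\
    (i < size ts -> (tm < nth tm ts i)%O);
  node_agg : forall p, valid t p -> agg (node_at t p) = partial_agg t p
}.

Definition query t : run S :=
  if is_leaf t then let* _ := tick Query 1 in ret (agg t)
  else
    let* _ := tick Query 5 in
    ret (op (op (agg (node_at t (left_finger t))) (agg t))
            (agg (node_at t (right_finger t)))).

Definition before tm y := if ents y is x :: _ then (tm < x.1)%O else false.
Definition after tm y :=
  if ents y is x :: s then ((last x s).1 < tm)%O else false.

Definition slot tm y := find (fun x => (tm <= x.1)%O) (ents y).
Definition has_time tm y := tm \in [seq x.1 | x <- ents y].

(* Walks up a spine to the lowest node whose subtree covers the searched time.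
   A non-root node of the left (right) spine covers tm iff tm comes before
   (after) all entries of its parent, hence the argument covered. *)
Fixpoint climb (covered : tree T S -> bool) t p : run addr :=
  if p is _ :: q then
    let* _ := tick Search 2 in
    if covered (node_at t q) then ret p else climb covered t q
  else ret p.

(* The first argument, an upper bound on the number of levels below p, is only
   there to make the recursion structural; likewise in the other walks down. *)
Fixpoint descend h tm t p : run addr :=
  let y := node_at t p in
  let* _ := tick Search (width y) in
  if has_time tm y || is_leaf y then ret p
  else if h is h'.+1 then descend h' tm t (slot tm y :: p) else ret p.

(* The finger that is nearer in the tree is found by comparing tm with the
   entries of the root: right of all of them, the walk up from the right finger
   is the shorter one; left of all of them, it is the walk from the left finger;
   otherwise both walks go up to the root. *)
Definition search tm t : run addr :=
  let* _ := tick Search 2 in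
  let* p := if after tm t then climb (after tm) t (right_finger t)
            else climb (before tm) t (left_finger t) in
  descend (height t) tm t p.

(* A node's aggregate recomputed from its own values and the aggregates stored
   in its children and, on the spines, in its parent. *)
Definition local_agg t p : S :=
  let y := node_at t p in
  let terms l r := node_terms (fun z => [:: agg z]) l r y in
  let above := if p is _ :: (_ :: _) as q then agg (node_at t q) else e in
  if nilp p then fold (terms true true)
  else if on_left p then op (fold (terms true false)) above
  else if on_right t p then op above (fold (terms false true))
  else fold (terms false false).

Definition repair_node t p : run (tree T S) :=
  let* _ := tick Repair (width (node_at t p)).+1 in
  ret (modify t p (with_agg (local_agg t p))).

Definition repair_off_spine t p : run (tree T S) :=
  if on_spine t p then ret t else repair_node t p.

Fixpoint repair_up t p : run (tree T S * addr) :=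
  if p is _ :: q then
    if on_spine t p then ret (t, p)
    else let* t1 := repair_node t p in repair_up t1 q
  else ret (t, p).

Fixpoint repair_spine (right : bool) h t p : run (tree T S) :=
  let y := node_at t p in
  if is_leaf y then ret t
  else if h is h'.+1 then
    let p' := (if right then (size (kids y)).-1 else 0) :: p in
    let* t1 := repair_node t p' in repair_spine right h' t1 p'
  else ret t.

(* Which of the spines contains a non-root affected node. *)
Definition hits : Type := (bool * bool)%type.
Definition mark t p (hit : hits) : hits :=
  (hit.1 || on_left p, hit.2 || on_right t p).

(* p0 is the node where the time was searched for, p the node where rebalancing
   stopped; one is an ancestor of the other.  Nodes below p involved in
   rebalancing and off the spines have been repaired by then. *)
Definition repair t p0 p (hit : hits) : run (tree T S) :=
  let* (t1, s) := repair_up t p in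
  let hit1 := mark t1 s hit in
  let top := if size p0 < size s then p0 else s in
  let* t2 := repair_node t1 top in
  let* t3 := if on_left top || nilp top && hit1.1
             then repair_spine false (height t2) t2 top else ret t2 in
  if on_right t3 top || nilp top && hit1.2
  then repair_spine true (height t3) t3 top else ret t3.

Definition split_kid i y :=
  match drop i (kids y) with
  | z :: zs =>
    let m := (arity z)./2 in
    match drop m (ents z) with
    | x :: es =>
      Node (agg y) (take i (ents y) ++ x :: drop i (ents y))
        (take i (kids y) ++
         [:: Node (agg z) (take m (ents z)) (take m.+1 (kids z)),
             Node e es (drop m.+1 (kids z)) & zs])
    | [::] => y
    end
  | [::] => y
  end.

(* The next three act on the i-th and i.+1-th children of y. *)
Definition merge_kids i y :=
  match drop i (ents y), drop i (kids y) with
  | x :: es, z1 :: z2 :: zs =>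
    Node (agg y) (take i (ents y) ++ es)
      (take i (kids y) ++
       Node (agg z1) (ents z1 ++ x :: ents z2) (kids z1 ++ kids z2) :: zs)
  | _, _ => y
  end.

Definition move_leftwards i y :=
  match drop i (ents y), drop i (kids y) with
  | x :: es, z1 :: z2 :: zs =>
    if ents z2 is x' :: es' then
      Node (agg y) (take i (ents y) ++ x' :: es)
        (take i (kids y) ++
         [:: Node (agg z1) (rcons (ents z1) x) (kids z1 ++ take 1 (kids z2)),
             Node (agg z2) es' (drop 1 (kids z2)) & zs])
    else y
  | _, _ => y
  end.

Definition move_rightwards i y :=
  match drop i (ents y), drop i (kids y) with
  | x :: es, z1 :: z2 :: zs =>
    if rev (ents z1) is x' :: es' then
      let k := (size (kids z1)).-1 in
      Node (agg y) (take i (ents y) ++ x' :: es)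
        (take i (kids y) ++
         [:: Node (agg z1) (rev es') (take k (kids z1)),
             Node (agg z2) (x :: ents z2) (drop k (kids z1) ++ kids z2) & zs])
    else y
  | _, _ => y
  end.

Fixpoint split_up t p (hit : hits) : run (tree T S * addr * hits) :=
  let* _ := tick Rebalance 1 in
  if arity (node_at t p) <= mu.*2 then ret (t, p, hit)
  else if p is i :: q then
    let* _ := tick Rebalance (width (node_at t q) + width (node_at t p)) in
    let t1 := modify t q (split_kid i) in
    let* t2 := repair_off_spine t1 (i :: q) in
    let* t3 := repair_off_spine t2 (i.+1 :: q) in
    split_up t3 q (mark t3 (i :: q) (mark t3 (i.+1 :: q) hit))
  else
    let* _ := tick Rebalance (width t).+1 in
    ret (split_kid 0 (Node e [::] [:: t]), [::], (true, true)).

Fixpoint merge_up t p (hit : hits) : run (tree T S * addr * hits) :=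
  let* _ := tick Rebalance 1 in
  if p is i :: q then
    if mu <= arity (node_at t p) then ret (t, p, hit)
    else
      let w := node_at t q in
      let left := (0 < i) && ((size (kids w) <= i.+1) || pick w i) in
      let l := if left then i.-1 else i in
      let sibling := (if left then l else l.+1) :: q in
      let* _ := tick Rebalance
                  (width w + width (node_at t p) + width (node_at t sibling)) in
      if arity (node_at t sibling) <= mu then
        let t1 := modify t q (merge_kids l) in
        if nilp q && (arity t1 == 1) then
          ret (node_at t1 [:: 0], [::], (true, true))
        else
          let* t2 := repair_off_spine t1 (l :: q) in
          merge_up t2 q (mark t2 (l :: q) hit)
      else
        let t1 := modify t q (if left then move_rightwards l
                              else move_leftwards l) in
        let* t2 := repair_off_spine t1 (l :: q) in
        let* t3 := repair_off_spine t2 (l.+1 :: q) in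
        merge_up t3 q (mark t3 (l :: q) (mark t3 (l.+1 :: q) hit))
  else ret (t, p, hit).

Definition insert_at tm v t p : run (tree T S) :=
  let y := node_at t p in
  let es := ents y in
  let j := slot tm y in
  let* _ := tick Search (width y) in
  let es' := if has_time tm y
             then take j es ++ [seq (x.1, op x.2 v) | x <- take 1 (drop j es)]
                            ++ drop j.+1 es
             else take j es ++ (tm, v) :: drop j es in
  ret (modify t p (with_ents es')).

Definition insert tm v t : run (tree T S) :=
  let* p := search tm t in
  let* t1 := insert_at tm v t p in
  let* (t2, q, hit) := split_up t1 p (mark t1 p (false, false)) in
  repair t2 p q hit.

Fixpoint first_leaf h t p : run addr :=
  let* _ := tick Search 1 in
  if is_leaf (node_at t p) then ret p
  else if h is h'.+1 then first_leaf h' t (0 :: p) else ret p.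

Fixpoint last_leaf h t p : run addr :=
  let y := node_at t p in
  let* _ := tick Search 1 in
  if is_leaf y then ret p
  else if h is h'.+1 then last_leaf h' t ((size (kids y)).-1 :: p) else ret p.

Definition put (j : nat) (x : seq (T * S)) y :=
  with_ents (take j (ents y) ++ x ++ drop j.+1 (ents y)) y.

(* Removes the j-th entry of the node at p; returns the new tree and the leaf
   that has lost an entry. *)
Definition evict_at (j : nat) t p : run (tree T S * addr) :=
  let y := node_at t p in
  if is_leaf y then
    let* _ := tick Search (width y) in
    ret (modify t p (put j [::]), p)
  else if mu < arity (node_at t (j.+1 :: p)) then
    let* l := first_leaf (height t) t (j.+1 :: p) in
    let es := ents (node_at t l) in
    let* _ := tick Search (width (node_at t l)).+1 in
    ret (modify (modify t l (put 0 [::])) p (put j (take 1 es)), l)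
  else
    let* l := last_leaf (height t) t (j :: p) in
    let es := ents (node_at t l) in
    let k := (size es).-1 in
    let* _ := tick Search (width (node_at t l)).+1 in
    ret (modify (modify t l (put k [::])) p (put j (drop k es)), l).

Definition evict tm t : run (tree T S) :=
  let* p := search tm t in
  let y := node_at t p in
  if has_time tm y then
    let* (t1, l) := evict_at (slot tm y) t p in
    let* (t2, q, hit) := merge_up t1 l (mark t1 l (false, false)) in
    repair t2 p q hit
  else ret t.

Definition apply_update (u : update T S) t : run (tree T S) :=
  match u with Insert tm v => insert tm v t | Evict tm => evict tm t end.

Fixpoint apply_updates (us : seq (update T S)) t : run (tree T S) :=
  if us is u :: us' then
    let* t1 := apply_update u t in apply_updates us' t1
  else ret t.

Definition window_size t := size (entries t).

Definition distance tm t :=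
  minn (count (fun x => (x.1 < tm)%O) (entries t))
       (count (fun x => (tm < x.1)%O) (entries t)).

End FingerBTree.

(* Main.v *)
(** Every step of an update costs O(mu), so only the shape of the tree matters.

    Let [c] be the node of height [k] where the search leaves the spine.  The
    spine child of [c] has all its entries between the searched time and the
    end of the window, and a whole child of the root lies on the other side;
    both have at least [2 ^ k.-1] entries, whence [k = O(log d)].  Everything
    the search does takes place below [c].

    Rebalancing is amortized with the potential that sums [phi (arity y)] over
    all nodes [y]: a change of one entry raises it by at most 3, whereas each
    split, merge or move lowers it by at least 1.

    Let rebalancing stop at [q].  If [q] is below [c], then so are all repaired
    nodes, and repair is paid for by the search.  Otherwise [q] is on the
    spine, rebalancing has climbed from the leaf level past [c], and it pays for
    the repair of the spine below [q]. *)

Require Import Defs.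
From mathcomp Require Import all_boot all_order zify.

Set Implicit Arguments.
Unset Strict Implicit.
Unset Printing Implicit Defensive.

(** * Running times *)

(** Two notions carry the shape. [wf] constrains only arities and depths: it follows from
    [finger_btree] and every update preserves it, so the amortized bound can run through a whole
    sequence of updates. [sim] relates trees with the same counts everywhere, which makes the
    rewriting of an aggregate invisible to every bound.

    Repair is compared with the time that search and rebalancing have really taken, so these need
    lower bounds on their times along with upper ones.

    The delicate point is that spine membership is tested in several trees, before, during and after
    rebalancing, whereas [c] is found in the first of them. Rebalancing that stops at [q] alters no
    number of children strictly above [q], and these numbers, together with the address, decide
    which ancestors of [q] are on a spine. Hence a spine node at or above [q] stays one
    throughout. *)

Lemma time_in_bind A B ph (m : run A) (k : A -> run B) :
  time_in ph (bind m k) = time_in ph m + time_in ph (k m.2).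
Proof. by rewrite /time_in /trace /bind count_cat. Qed.

Lemma bind_res A B (m : run A) (k : A -> run B) : (bind m k).2 = (k m.2).2.
Proof. by []. Qed.

Lemma time_in_tick ph ph' n :
  time_in ph (tick ph' n) = if ph == ph' then n else 0.
Proof.
rewrite /time_in /trace /tick /= count_nseq /= eq_sym.
by case: (_ == _); rewrite ?mul1n.
Qed.

Lemma time_in_ret A ph (a : A) : time_in ph (ret a) = 0.
Proof. by []. Qed.

Definition timeE := (time_in_bind, time_in_tick, time_in_ret).

Lemma time_phases A (m : run A) : time_in Query m = 0 ->
  time m = time_in Search m + time_in Rebalance m + time_in Repair m.
Proof.
rewrite /time /time_in; elim: (trace m) => //= ph s IHs.
by case: ph => //= /IHs ->; lia.
Qed.

(** Suffixes of an address are its ancestors, and the ancestors of one node form a chain ordered by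
    depth. *)
Lemma suffix_comparable (A : eqType) (s1 s2 s : seq A) :
  suffix s1 s -> suffix s2 s -> size s1 <= size s2 -> suffix s1 s2.
Proof.
move=> s1s s2s le12; have le2 := size_suffix s2s.
move: s1s s2s; rewrite !suffixE => /eqP s1E /eqP s2E.
rewrite -[X in drop _ X]s2E drop_drop -[X in _ == X]s1E; apply/eqP; congr drop; lia.
Qed.

Lemma suffix_consr (A : eqType) (s1 s2 : seq A) x :
  suffix s1 (x :: s2) -> s1 = x :: s2 \/ suffix s1 s2.
Proof.
case/suffixP=> -[|y s] /= => [<-|[_ ->]]; first by left.
by right; apply: suffix_suffix.
Qed.

Lemma sumn_map_set_nth A (f : A -> nat) x0 s i x : i < size s ->
  sumn (map f (set_nth x0 s i x)) + f (nth x0 s i) = sumn (map f s) + f x.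
Proof.
elim: s i => [|y s IHs] [|i] //=; first lia.
by rewrite ltnS => /IHs; lia.
Qed.

Section Shape.

Context {disp : Order.disp_t} {T : orderType disp} {S : Type} {e : S}.
Context (op : Monoid.law e) (mu : nat).
Context (pick : tree T S -> nat -> bool).
Hypothesis mu_ge2 : 2 <= mu.

Implicit Types (t y z : tree T S) (p q : addr) (tm : T) (v : S).

Local Notation node_at := (node_at (e := e)).
Local Notation valid := (valid (e := e)).
Local Notation modify := (modify (e := e)).
Local Notation empty := (empty (e := e)).
Local Notation split_kid := (split_kid (e := e)).
Local Notation mark := (mark (e := e)).
Local Notation climb := (climb (e := e)).
Local Notation descend := (descend (e := e)).
Local Notation search := (search (e := e)).
Local Notation first_leaf := (first_leaf (e := e)).
Local Notation last_leaf := (last_leaf (e := e)).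
Local Notation evict_at := (evict_at (e := e)).
Local Notation all_last := (all_last (e := e)).
Local Notation on_spine := (on_spine (e := e)).
Local Notation on_right := (on_right (e := e)).

(** * Shape of a tree *)

(** The hypothesis on the children goes through [nth] rather than membership: [S] is an arbitrary
    type, so trees have no decidable equality. *)
Lemma tree_nested_ind (P : tree T S -> Prop) :
  (forall a es zs, (forall i, i < size zs -> P (nth empty zs i)) ->
     P (Node a es zs)) -> forall t, P t.
Proof.
move=> PNode; fix IH 1 => -[a es zs]; apply: PNode.
elim: zs => [|z zs IHzs] [|i] lti; try by case: (notF lti).
  exact: (IH z).
exact: (IHzs i lti).
Qed.

Lemma node_at_cat t p q : node_at t (p ++ q) = node_at (node_at t q) p.
Proof. by elim: p => //= i p ->. Qed.

Lemma valid_cat t p q : valid t (p ++ q) = valid t q && valid (node_at t q) p.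
Proof. by elim: p => [|i p /= ->]; rewrite ?andbT //= node_at_cat andbA. Qed.

Lemma all_last_cat t p q :
  all_last t (p ++ q) = all_last (node_at t q) p && all_last t q.
Proof. by elim: p => //= i p ->; rewrite node_at_cat andbA. Qed.

Lemma valid_suffix t p q : suffix q p -> valid t p -> valid t q.
Proof. by case/suffixP=> p' ->; rewrite valid_cat => /andP[]. Qed.

Lemma node_at_modify t p f : node_at (modify t p f) p = f (node_at t p).
Proof. by elim: p f => //= i p IHp f; rewrite IHp /= nth_set_nth /= eqxx. Qed.

(* The numbers of children along the path above p: on_right t p depends on
   nothing else. *)
Fixpoint anc t p : seq nat :=
  if p is _ :: q then size (kids (node_at t q)) :: anc t q else [::].

Lemma anc_cat t p q : anc t (p ++ q) = anc (node_at t q) p ++ anc t q.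
Proof. by elim: p => //= i p ->; rewrite node_at_cat. Qed.

Lemma size_anc t p : size (anc t p) = size p.
Proof. by elim: p => //= i p ->. Qed.

Lemma anc_modify t p f : valid t p -> anc (modify t p f) p = anc t p.
Proof.
elim: p f => //= i p IHp f /andP[vp ip].
rewrite IHp // node_at_modify /= size_set_nth; congr (_ :: _); lia.
Qed.

Lemma all_last_anc t t' p : anc t p = anc t' p -> all_last t p = all_last t' p.
Proof. by elim: p => //= i p IHp [-> /IHp ->]. Qed.

(** [on_left] depends on the address alone and [on_right] on the child counts above the node, so
    spine membership can be carried over between trees that differ only at or below [q]. *)
Lemma on_spine_anc t t' p q : suffix p q -> anc t q = anc t' q ->
  on_spine t p = on_spine t' p.
Proof.
case/suffixP=> d ->; rewrite !anc_cat => /(congr1 (drop (size d))).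
rewrite !drop_size_cat ?size_anc // => eq_anc.
by rewrite /Defs.on_spine /Defs.on_right (all_last_anc eq_anc).
Qed.

Lemma on_spine_suffix t p q : suffix p q -> on_spine t q -> on_spine t p.
Proof.
case/suffixP=> d ->; rewrite /Defs.on_spine /on_left /Defs.on_right.
case: p => [|i p]; rewrite ?cats0 //= all_cat all_last_cat.
by case: d => //= j d /orP[|] => [|] /andP[_ ->]; rewrite ?orbT.
Qed.

(* Same numbers of entries and children everywhere. *)
Definition sim t t' := forall p,
  size (ents (node_at t p)) = size (ents (node_at t' p)) /\
  size (kids (node_at t p)) = size (kids (node_at t' p)).

Lemma sim_trans t' t t'' : sim t t' -> sim t' t'' -> sim t t''.
Proof. by move=> s s' p; case: (s p) => -> ->. Qed.

Lemma sim_node_at t t' p : sim t t' -> sim (node_at t p) (node_at t' p).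
Proof. by move=> s q; rewrite -!node_at_cat. Qed.

Lemma sim_arity t t' p : sim t t' -> arity (node_at t p) = arity (node_at t' p).
Proof. by move=> s; rewrite /arity (s p).1. Qed.

Lemma sim_width t t' p : sim t t' -> width (node_at t p) = width (node_at t' p).
Proof. by move=> s; rewrite /width (s p).1 (s p).2. Qed.

Lemma sim_valid t t' p : sim t t' -> valid t p = valid t' p.
Proof. by move=> s; elim: p => //= i p ->; rewrite (s p).2. Qed.

Lemma sim_anc t t' p : sim t t' -> anc t p = anc t' p.
Proof. by move=> s; elim: p => //= i p ->; rewrite (s p).2. Qed.

Lemma sim_node t t' : size (ents t) = size (ents t') ->
  size (kids t) = size (kids t') ->
  (forall i, sim (nth empty (kids t) i) (nth empty (kids t') i)) -> sim t t'.
Proof.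
move=> es zs s p; case/lastP: p => // p i.
by rewrite -cats1 !node_at_cat; apply: s.
Qed.

Lemma sim_modify t p f : valid t p -> sim (node_at t p) (f (node_at t p)) ->
  sim t (modify t p f).
Proof.
elim: p f => //= i p IHp f /andP[vp ip] s; apply: IHp => //.
apply: sim_node => //= [|j]; first by rewrite size_set_nth; lia.
by rewrite nth_set_nth /=; case: eqP => // ->.
Qed.

(** * Potential *)

(* Splitting a node of arity [mu.*2.+1] leaves arities [mu.+1] and [mu], hence
   total potential 1 out of 5, and raises the parent by at most 3.  Merging
   arities [mu.-1] and [mu] releases 4 and raises the parent by at most 2.  A
   move releases 2 at the underfull node and raises its sibling by at most 1. *)
Definition phi a := if a < mu then 3 else if a == mu then 1
  else if a < mu.*2 then 0 else if a == mu.*2 then 2 else 5.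

Lemma phi_cases a :
  [\/ a < mu /\ phi a = 3, a = mu /\ phi a = 1, mu < a < mu.*2 /\ phi a = 0
    | mu.*2 <= a /\ phi a = (if a == mu.*2 then 2 else 5)].
Proof.
rewrite /phi; case: ltngtP => am; [by constructor 1| |by constructor 2].
by case: ltnP => a2; [constructor 3|constructor 4].
Qed.

Lemma phi_lt a : a < mu -> phi a = 3.
Proof. by rewrite /phi => ->. Qed.

Lemma phi_mu : phi mu = 1.
Proof. by rewrite /phi ltnn eqxx. Qed.

Lemma phi_mid a : mu < a < mu.*2 -> phi a = 0.
Proof. by case: (phi_cases a) => -[] *; lia. Qed.

Lemma phi_over a : mu.*2 < a -> phi a = 5.
Proof. by case: (phi_cases a) => -[? ->]; do ?case: eqP => ?; lia. Qed.

Lemma phi_le3 a : a <= mu.*2 -> phi a <= 3.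
Proof. by case: (phi_cases a) => -[? ->]; do ?case: eqP => ?; lia. Qed.

(** The largest jump, from 2 to 5, is at [mu.*2]. *)
Lemma phiS a : phi a.+1 <= phi a + 3.
Proof.
by case: (phi_cases a) => -[? ->]; case: (phi_cases a.+1) => -[? ->];
  do ?case: eqP => ?; lia.
Qed.

(** Going down, the largest jump is from 1 at [mu] to 3 at [mu.-1]. *)
Lemma phi_pred a : phi a <= phi a.+1 + 2.
Proof.
by case: (phi_cases a) => -[? ->]; case: (phi_cases a.+1) => -[? ->];
  do ?case: eqP => ?; lia.
Qed.

Lemma phi_pred_gt a : mu <= a < mu.*2 -> phi a <= phi a.+1 + 1.
Proof.
by case: (phi_cases a) => -[? ->]; case: (phi_cases a.+1) => -[? ->];
  do ?case: eqP => ?; lia.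
Qed.

Fixpoint pot y := let: Node _ es zs := y in
  phi (size es).+1 + sumn (map pot zs).

Lemma potE y : pot y = phi (arity y) + sumn (map pot (kids y)).
Proof. by case: y. Qed.

(** A local change alters the potential by as much as it alters that of the subtree; sums on both
    sides avoid truncated subtraction. *)
Lemma pot_modify t p f : valid t p ->
  pot (modify t p f) + pot (node_at t p) = pot t + pot (f (node_at t p)).
Proof.
elim: p f => [|i p IHp] f /=; first by rewrite addnC.
case/andP=> vp ip; have {IHp} := IHp (fun y => Node (agg y) (ents y)
  (set_nth empty (kids y) i (f (nth empty (kids y) i)))) vp.
have := sumn_map_set_nth pot empty (f (nth empty (kids (node_at t p)) i)) ip.
rewrite [pot (node_at _ _)]potE /= -/(arity _). lia.
Qed.

Lemma sim_pot t t' : sim t t' -> pot t = pot t'.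
Proof.
elim/tree_nested_ind: t t' => a es zs IH t' s.
rewrite !potE (sim_arity [::] s : arity _ = arity t') /=; congr (_ + _).
have [_ /= eq_zs] := s [::]; congr sumn.
apply: (@eq_from_nth _ 0); rewrite !size_map // => i ltiz.
rewrite !(nth_map empty) -?eq_zs //; apply: IH => //.
exact: (sim_node_at [:: i] s).
Qed.

(** * Balanced trees *)

(* [y] has height [h] and all nodes strictly below [y] have a legal arity. *)
Fixpoint uniform h y : bool :=
  if h is h'.+1 then (size (kids y) == arity y) &&
    all (fun z => (mu <= arity z <= mu.*2) && uniform h' z) (kids y)
  else nilp (kids y).

(* A root that is a leaf may be empty, i.e. of arity 1. *)
Definition min_arity (root : bool) h := if root then (0 < h).+1 else mu.
Definition goodp root h y := (min_arity root h <= arity y <= mu.*2) && uniform h y.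
Definition good := goodp false.
Definition wf := goodp true.

Lemma uniformS h y :
  uniform h.+1 y = (size (kids y) == arity y) && all (good h) (kids y).
Proof. by []. Qed.

Lemma sim_uniform h t t' : sim t t' -> uniform h t -> uniform h t'.
Proof.
elim: h t t' => [|h IHh] t t' s; have [eq_es eq_zs] := s [::].
  by rewrite /= /nilp; move: eq_zs => /= ->.
rewrite !uniformS /arity => /andP[szt /(all_nthP empty) gt].
move: eq_es eq_zs => /= eq_es eq_zs; rewrite -eq_zs -eq_es szt /=.
apply/(all_nthP empty) => i; rewrite -eq_zs => /gt /andP[ar un].
have si := sim_node_at [:: i] s.
by rewrite /good /goodp -(sim_arity [::] si : arity _ = arity _) ar (IHh _ _ si).
Qed.

Lemma sim_goodp r h t t' : sim t t' -> goodp r h t -> goodp r h t'.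
Proof.
move=> s /andP[ar /(sim_uniform s) un].
by rewrite /goodp un -(sim_arity [::] s : arity _ = arity _) ar.
Qed.

Lemma uniform_height h y : uniform h y -> height y = h.
Proof.
elim: h y => [|h IHh] [a es [|z zs]] //=.
by case/and3P=> _ /andP[_ /IHh ->].
Qed.

(* All nodes of t are fine, except that nothing is said about the subtree
   at p, which is expected to have height h. *)
Fixpoint ctx h p t : Prop := if p is i :: q then
    ctx h.+1 q t /\ let y := node_at t q in
    [/\ min_arity (nilp q) h.+1 <= arity y <= mu.*2, size (kids y) = arity y,
        i < size (kids y) &
        forall j, j < size (kids y) -> j != i -> good h (nth empty (kids y) j)]
  else True.

Lemma ctx_cons h i q t : ctx h (i :: q) t -> ctx h.+1 q t /\
  let y := node_at t q in
  [/\ min_arity (nilp q) h.+1 <= arity y <= mu.*2, size (kids y) = arity y,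
      i < size (kids y) &
      forall j, j < size (kids y) -> j != i -> good h (nth empty (kids y) j)].
Proof. by []. Qed.

Lemma ctx_valid h p t : ctx h p t -> valid t p.
Proof. by elim: p h => //= i p IHp h [/IHp -> []]. Qed.

(** No condition on [f]: [ctx] is silent about the subtree at [p], so the invariant may be broken
    there and restored later by [ctx_close]. *)
Lemma ctx_modify h p t f : ctx h p t -> ctx h p (modify t p f).
Proof.
elim: p h f => //= i q IHq h f [ctxq]; have vq := ctx_valid ctxq.
case=> ar sz iq gd; split; first exact: IHq.
rewrite node_at_modify /arity /= size_set_nth (maxn_idPr iq).
by split=> // j jq ji; rewrite nth_set_nth /= (negbTE ji); apply: gd.
Qed.

Lemma ctx_sim h p t t' : sim t t' -> ctx h p t -> ctx h p t'.
Proof.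
move=> s; elim: p h => //= i q IHq h [/IHq ctxq].
rewrite (sim_arity q s) (s q).2 => -[ar sz iq gd]; split=> //; split=> // j jq ji.
by apply: sim_goodp (gd j jq ji); apply: (sim_node_at (j :: q)).
Qed.

Lemma ctx_close h p t : ctx h p t -> goodp (nilp p) h (node_at t p) ->
  wf (h + size p) t.
Proof.
elim: p h => [|i q IHq] h /=; first by rewrite addn0.
case=> ctxq [ar sz iq gd] gi; rewrite -addSnnS; apply: IHq => //.
rewrite /goodp ar uniformS sz eqxx /=; apply/(all_nthP empty) => j jq.
by case: (eqVneq j i) => [->|/gd]; [|apply].
Qed.

Lemma ctx_open h p t : valid t p -> wf (h + size p) t ->
  ctx h p t /\ goodp (nilp p) h (node_at t p).
Proof.
elim: p h => [|i q IHq] h /=; first by rewrite addn0.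
case/andP=> vq iq; rewrite -addSnnS => /(IHq _ vq)[ctxq /andP[ar]].
rewrite uniformS => /andP[/eqP sz /(all_nthP empty) gd].
by do !split=> // *; apply: gd.
Qed.

Lemma wf_valid_size H t p : wf H t -> valid t p -> size p <= H.
Proof.
move=> wft vp; suff: size p <= H /\ goodp (nilp p) (H - size p) (node_at t p).
  by case.
elim: p vp => [|i p IHp] /=; first by rewrite subn0.
case/andP=> /IHp[leH]; case E: (H - size p) => [|h] /andP[_].
  by rewrite /= => /nilP->.
rewrite uniformS => /andP[_ /(all_nthP empty) gd] /gd.
by rewrite (_ : H - (size p).+1 = h); [split=> //; lia | lia].
Qed.

Lemma wf_node_at H t p : wf H t -> valid t p ->
  ctx (H - size p) p t /\ goodp (nilp p) (H - size p) (node_at t p).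
Proof.
by move=> wft vp; apply: ctx_open => //; rewrite subnK ?(wf_valid_size wft).
Qed.

(* Bounds the width of any node of arity at most [mu.*2.+1]. *)
Definition W := 4 * mu + 4.

Lemma uniform_width h y : uniform h y -> width y <= (arity y).*2.
Proof.
case: h => [|h] /=; rewrite /width /arity; first by move/nilP-> => /=; lia.
by case/andP=> /eqP->; lia.
Qed.

Lemma wf_width H t p : wf H t -> valid t p -> width (node_at t p) <= W.
Proof.
move=> wft /(wf_node_at wft)[_ /andP[/andP[_ ar] /uniform_width]]; rewrite /W; lia.
Qed.

Lemma wf_leaf H t p : wf H t -> valid t p ->
  is_leaf (node_at t p) = (size p == H).
Proof.
move=> wft vp; have := wf_valid_size wft vp.
have [_ /andP[_]] := wf_node_at wft vp; rewrite /is_leaf.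
case E: (H - size p) => [|h] /=; first by move=> ->; lia.
by rewrite /nilp /arity => /andP[/eqP->]; lia.
Qed.


Local Arguments uniform : simpl never.

Lemma uniform0 y : uniform 0 y = nilp (kids y).
Proof. by []. Qed.

(** * Rebalancing *)

(** Taking the separator [x] out leaves each half of an inner node with one child more than entries;
    in a leaf both lists of children are empty. With [es1] or [es2] empty this detaches an outermost
    child. *)
Lemma uniform_split h a es1 x es2 zs a1 a2 :
  uniform h (Node a (es1 ++ x :: es2) zs) ->
  uniform h (Node a1 es1 (take (size es1).+1 zs)) /\
  uniform h (Node a2 es2 (drop (size es1).+1 zs)).
Proof.
case: h => [|h]; first by rewrite !uniform0 => /nilP /= ->.
rewrite !uniformS /arity /= -[in all _ zs](cat_take_drop (size es1).+1 zs).
rewrite all_cat size_cat /= => /and3P[/eqP sz -> ->].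
have lt1 : (size es1).+1 <= size zs by lia.
by rewrite size_takel // size_drop sz eqxx; split=> //; lia.
Qed.

Lemma uniform_merge h a1 es1 zs1 a2 es2 zs2 a x :
  uniform h (Node a1 es1 zs1) -> uniform h (Node a2 es2 zs2) ->
  uniform h (Node a (es1 ++ x :: es2) (zs1 ++ zs2)).
Proof.
case: h => [|h]; first by rewrite !uniform0 => /nilP /= -> /nilP /= ->.
rewrite !uniformS /arity /= all_cat !size_cat /=.
by case/andP=> /eqP-> -> /andP[/eqP-> ->]; lia.
Qed.

(** The change of [phi] at the parent is kept apart, because the lemma serves both an arbitrary
    parent and the fresh parent of a split root. *)
Lemma split_kid_spec h i y : let z := nth empty (kids y) i in
  size (kids y) = arity y -> i < size (kids y) -> arity y <= mu.*2 ->
  (forall j, j < size (kids y) -> j != i -> good h (nth empty (kids y) j)) ->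
  uniform h z -> arity z = mu.*2.+1 ->
  let y' := split_kid i y in
  [/\ uniform h.+1 y', arity y' = (arity y).+1
    & pot y' + phi (arity y) + 4 = pot y + phi (arity y).+1].
Proof.
move=> z sz iy ary gd uz az; rewrite /split_kid (drop_nth empty) // -/z az.
(* The left half keeps [mu] entries; one goes up to the parent, and the right half has [mu.-1]
   entries. *)
have -> : (mu.*2.+1)./2 = mu by lia.
have gt : all (good h) (take i (kids y)).
  apply/(all_nthP empty) => j; rewrite size_takel ?(ltnW iy) // => ji.
  by rewrite nth_take //; apply: gd; lia.
have gdr : all (good h) (drop i.+1 (kids y)).
  apply/(all_nthP empty) => j; rewrite size_drop => ji.
  by rewrite nth_drop; apply: gd; lia.
have potkids : pot y = phi (arity y) + (sumn (map pot (take i (kids y)))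
    + (pot z + sumn (map pot (drop i.+1 (kids y))))).
  rewrite potE -[in LHS](cat_take_drop i (kids y)) (drop_nth empty) //.
  by rewrite map_cat sumn_cat.
case: z => [a es zs] in uz az potkids *; rewrite /= in potkids *.
case: az => szes; have ltmu : mu < size es by lia.
have szt : size (take mu es) = mu by rewrite size_takel // ltnW.
case D: (drop mu es) => [|x es2].
  by have := size_drop mu es; rewrite D /=; lia.
have szes2 : size es2 = mu.-1.
  by have := size_drop mu es; rewrite D /=; lia.
have := @uniform_split h a (take mu es) x es2 zs a e.
rewrite -D cat_take_drop szt => /(_ uz)[u1 u2]; split.
- have ei : i <= size (ents y) by move: sz; rewrite /arity; lia.
  rewrite uniformS /arity /= !size_cat /= !size_drop !size_takel ?(ltnW iy) //.
  rewrite all_cat gt /= gdr andbT /good /goodp u1 u2 /arity /= szt szes2.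
  by move: sz; rewrite /arity; lia.
- have := congr1 size (cat_take_drop i (ents y)).
  by rewrite /arity /= !size_cat /=; lia.
rewrite /= size_cat /= !map_cat !sumn_cat /= szt szes2 {}potkids.
have -> : size (take i (ents y)) + (size (drop i (ents y))).+1 = arity y.
  by rewrite addnS -size_cat cat_take_drop.
have -> : sumn (map pot zs) = sumn (map pot (take mu.+1 zs))
    + sumn (map pot (drop mu.+1 zs)).
  by rewrite -sumn_cat -map_cat cat_take_drop.
rewrite (phi_mid (a := mu.+1)) 1?(phi_over (a := (size es).+1)); try lia.
have -> : mu.-1.+1 = mu by lia.
by rewrite phi_mu; lia.
Qed.

(* lia case-splits on every boolean atom of the context. *)
Ltac slia := repeat match goal with H : is_true ?b |- _ =>
    lazymatch b with
    | leq _ _ => fail | andb _ _ => fail | negb _ => fail | eq_op _ _ => fail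
    | _ => clear H
    end
  end; lia.

(** * Merges and moves between adjacent siblings *)

Section Siblings.

Variables (h l : nat) (y : tree T S).
Let z1 := nth empty (kids y) l.
Let z2 := nth empty (kids y) l.+1.
Hypotheses (szy : size (kids y) = arity y) (ly : l.+1 < size (kids y)).
Hypothesis gd : forall j, j < size (kids y) -> j != l -> j != l.+1 ->
  good h (nth empty (kids y) j).
Hypotheses (u1 : uniform h z1) (u2 : uniform h z2).

Lemma siblings_split : exists x es,
  [/\ drop l (ents y) = x :: es, arity y = (l + size es).+2,
      drop l (kids y) = [:: z1, z2 & drop l.+2 (kids y)]
    & [/\ size (take l (ents y)) = l, all (good h) (take l (kids y)),
      all (good h) (drop l.+2 (kids y)),
      size (take l (kids y)) = l &
      size (drop l.+2 (kids y)) = size es] ].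
Proof.
case D: (drop l (ents y)) => [|x es].
  by have := size_drop l (ents y); rewrite D /=; move: szy ly; rewrite /arity; slia.
exists x, es.
have szes := size_drop l (ents y); rewrite D /= in szes.
have ary : arity y = (l + size es).+2 by rewrite /arity; slia.
split=> //; first by rewrite (drop_nth empty (ltnW ly)) (drop_nth empty ly).
rewrite !size_takel ?size_drop; try slia.
split=> //; last by slia.
- apply/(all_nthP empty) => j; rewrite size_takel; last slia.
  by move=> jl; rewrite nth_take //; apply: gd; slia.
- apply/(all_nthP empty) => j; rewrite size_drop => jl.
  by rewrite nth_drop; apply: gd; slia.
Qed.

Lemma pot_siblings : pot y = phi (arity y) + (sumn (map pot (take l (kids y)))
  + (pot z1 + (pot z2 + sumn (map pot (drop l.+2 (kids y)))))).
Proof.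
rewrite potE -[in LHS](cat_take_drop l (kids y)) (drop_nth empty); last slia.
by rewrite (drop_nth empty) // map_cat sumn_cat.
Qed.

Lemma merge_kids_spec :
  arity z1 = mu.-1 /\ arity z2 = mu \/ arity z1 = mu /\ arity z2 = mu.-1 ->
  let y' := merge_kids l y in
  [/\ uniform h.+1 y', arity y' = (arity y).-1 & pot y' < pot y].
Proof.
have [x [es [D ar Dk [st g1 g2 sk1 sk2]]]] := siblings_split.
have := pot_siblings; move: u1 u2; rewrite /merge_kids D Dk.
case: (z1) => a1 es1 zs1; case: (z2) => a2 es2 zs2; rewrite ar /arity /=.
move=> v1 v2 -> ar12; have sum12 : size es1 + size es2 = mu.*2 - 3 by slia.
have v := uniform_merge a1 x v1 v2; split; last 1 first.
- rewrite size_cat !map_cat !sumn_cat /= !size_cat /= map_cat sumn_cat st.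
  (* The merged node has arity [mu.*2.-1], which exceeds [mu] because [2 <= mu]; its potential is
     0. *)
  rewrite (phi_mid (a := (size es1 + (size es2).+1).+1)); last slia.
  have := phi_pred (l + size es).+1.
  by case: ar12 => -[-> ->]; rewrite phi_mu (phi_lt (a := mu.-1)); slia.
- rewrite uniformS /arity /= !size_cat /= st sk1 sk2 addnS eqxx all_cat g1 /=.
  rewrite g2 andbT /good /goodp v andbT /arity /= size_cat /=.
  by clear -sum12 mu_ge2; slia.
by rewrite size_cat st.
Qed.

(** A move is a split of the donor into a node without entries and the rest, followed by a merge of
    the former into the receiver around the old separator. *)
Lemma move_leftwards_spec : 
  arity z1 = mu.-1 -> mu < arity z2 <= mu.*2 ->
  let y' := move_leftwards l y in
  [/\ uniform h.+1 y', arity y' = arity y & pot y' < pot y].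
Proof.
have [x [es [D ar Dk [st g1 g2 sk1 sk2]]]] := siblings_split.
have := pot_siblings; move: u1 u2; rewrite /move_leftwards D Dk.
case: (z1) => a1 es1 zs1; case: (z2) => a2 [|x' es2] zs2; rewrite /arity /=.
  by slia.
move=> v1 v2 potE0 ar1 ar2.
have [w1 w2] := @uniform_split h a2 [::] x' es2 zs2 a2 a2 v2.
have w := uniform_merge a1 x v1 w1; rewrite /= cats1 in w.
split.
- rewrite uniformS /arity /= !size_cat /= st sk1 sk2 addnS addnS eqxx all_cat g1 /=.
  by rewrite g2 andbT /good /goodp w w2 /arity /= size_rcons /=; slia.
- by move: ar; rewrite /arity size_cat st /=; slia.
rewrite /= {}potE0 !size_cat /= !map_cat !sumn_cat /= map_cat sumn_cat st.
have -> : sumn (map pot zs2) = sumn (map pot (take 1 zs2))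
    + sumn (map pot (drop 1 zs2)).
  by rewrite -sumn_cat -map_cat cat_take_drop.
rewrite size_rcons ar1 (phi_lt (a := mu.-1)); last slia.
have -> : mu.-1.+1 = mu by slia.
have ph : phi (size es2).+1 <= phi (size es2).+2 + 1 by apply: phi_pred_gt; slia.
by move: ar; rewrite /arity addnS phi_mu => ->; slia.
Qed.

Lemma move_rightwards_spec : 
  arity z2 = mu.-1 -> mu < arity z1 <= mu.*2 ->
  let y' := move_rightwards l y in
  [/\ uniform h.+1 y', arity y' = arity y & pot y' < pot y].
Proof.
have [x [es [D ar Dk [st g1 g2 sk1 sk2]]]] := siblings_split.
have := pot_siblings; move: u1 u2; rewrite /move_rightwards D Dk.
case: (z1) => a1 es1 zs1; case: (z2) => a2 es2 zs2; rewrite /arity /=.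
case/lastP: es1 => [|es1 x'] /=; first by slia.
rewrite rev_rcons revK; set k := (size zs1).-1.
move=> v1 v2 potE0 ar1 ar2.
(* [move_rightwards] locates the cut by counting children, [uniform_split] by counting entries; the
   two agree in an inner node, and in a leaf there is nothing to cut. *)
have Dk1 : (take k zs1 = take (size es1).+1 zs1) /\
           (drop k zs1 = drop (size es1).+1 zs1).
  move: v1; rewrite /k; case: (h) => [|h']; first by rewrite uniform0 => /nilP /= ->.
  by rewrite uniformS /arity /= size_rcons => /andP[/eqP-> _].
case: Dk1 => -> ->; rewrite -cats1 in v1.
have [w1 w2] := @uniform_split h a1 es1 x' [::] zs1 a1 a1 v1.
have w := uniform_merge a2 x w2 v2; rewrite /= in w.
rewrite size_rcons in potE0 ar2.
split.
- rewrite uniformS /arity /= !size_cat /= st sk1 sk2 addnS addnS eqxx all_cat g1 /=.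
  by rewrite g2 andbT /good /goodp w w1 /arity /=; slia.
- by move: ar; rewrite /arity size_cat st /=; slia.
rewrite /= {}potE0 !size_cat /= !map_cat !sumn_cat /= map_cat sumn_cat st.
have -> : sumn (map pot zs1) = sumn (map pot (take (size es1).+1 zs1))
    + sumn (map pot (drop (size es1).+1 zs1)).
  by rewrite -sumn_cat -map_cat cat_take_drop.
rewrite ar1 (phi_lt (a := mu.-1)); last slia.
have -> : mu.-1.+1 = mu by slia.
have ph : phi (size es1).+1 <= phi (size es1).+2 + 1 by apply: phi_pred_gt; slia.
by move: ar; rewrite /arity addnS phi_mu => ->; slia.
Qed.

End Siblings.


Lemma sim_with_agg a y : sim y (with_agg a y).
Proof. by apply: sim_node. Qed.

Lemma repair_node_sim t p : valid t p -> sim t (repair_node op t p).2.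
Proof. by move=> vp; apply: sim_modify => //; apply: sim_with_agg. Qed.

Lemma repair_node_time ph t p : time_in ph (repair_node op t p) =
  if ph == Repair then (width (node_at t p)).+1 else 0.
Proof. by rewrite !timeE addn0. Qed.

Lemma repair_off_spine_sim t p : valid t p -> sim t (repair_off_spine op t p).2.
Proof.
by rewrite /repair_off_spine; case: ifP => // _; apply: repair_node_sim.
Qed.

Lemma repair_off_spine_time ph t p : time_in ph (repair_off_spine op t p) <=
  if ph == Repair then (width (node_at t p)).+1 else 0.
Proof.
by rewrite /repair_off_spine; case: ifP => // _; rewrite repair_node_time.
Qed.

(* Bounds both the rebalancing and the repair cost of one rebalancing step. *)
Definition K := 4 * W.

(* n counts the splits, merges and moves. *)
Definition rebalanced h p t (r : run (tree T S * addr * hits)) :=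
  let t' := r.2.1.1 in let q := r.2.1.2 in
  exists n H,
  [/\ [/\ wf H t', H <= (h + size p).+1, valid t' q, suffix q p
        & anc t' q = anc t q],
      n <= (size p).+1 /\ size p <= size q + n,
      n <= time_in Rebalance r <= K * n.+1,
      time_in Repair r <= K * n
    & n + pot t' <= pot t].

Lemma rebalanced_stop h p t hit r : r = (nseq 1 Rebalance, (t, p, hit)) ->
  ctx h p t -> goodp (nilp p) h (node_at t p) -> rebalanced h p t r.
Proof.
move=> -> ctxp gp; exists 0, (h + size p).
rewrite /= (ctx_close ctxp) // (ctx_valid ctxp) suffix_refl addn0.
by split=> //; rewrite /K /W /time_in /=; lia.
Qed.

(** A step may change the number of children of [q], but [anc t q] records only those of the proper
    ancestors of [q]. Each step climbs one level and costs potential, so the count [n] grows with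
    both. *)
Lemma rebalanced_step h i q t t' r r' :
  anc t' q = anc t q -> pot t' < pot t -> rebalanced h.+1 q t' r' ->
  r.2 = r'.2 -> time_in Rebalance r' < time_in Rebalance r ->
  time_in Rebalance r <= time_in Rebalance r' + K ->
  time_in Repair r <= time_in Repair r' + K -> rebalanced h (i :: q) t r.
Proof.
move=> anct pott [n [H [[wfH leH vq sq ancq] [n1 n2] n3 n4 n5]]] eqr2 re1 re2 rep.
exists n.+1, H; rewrite eqr2 wfH vq ancq /=; split=> //; try lia.
split=> //; try lia.
- by apply: suffix_trans sq (suffix_cons _ _).
- case/suffixP: sq anct ancq => d ->; rewrite !anc_cat.
  by move/(congr1 (drop (size d))); rewrite !drop_size_cat ?size_anc.
Qed.

Lemma ctx_kid_width h q t i : ctx h q t -> uniform h (node_at t q) ->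
  i < size (kids (node_at t q)) ->
  valid t (i :: q) /\ width (node_at t (i :: q)) <= W.
Proof.
move=> ctxq; rewrite /= (ctx_valid ctxq); case: h {ctxq} => [|h].
  by rewrite uniform0 => /nilP->.
rewrite uniformS => /andP[_ /(all_nthP empty) gd] iq; split=> //.
by have /andP[/andP[_ ar] /uniform_width] := gd i iq; rewrite /W; slia.
Qed.

Lemma split_up_spec h p t hit : ctx h p t -> uniform h (node_at t p) ->
  min_arity (nilp p) h <= arity (node_at t p) <= mu.*2.+1 ->
  rebalanced h p t (split_up op mu t p hit).
Proof.
elim: p h t hit => [|i q IHq] h t hit ctxp unp /andP[arp1 arp2].
  rewrite /=; case: (leqP (arity t) mu.*2) => art.
    by apply: rebalanced_stop => //; rewrite /goodp unp art arp1.
  have art2 : arity t = mu.*2.+1 by rewrite /= in arp2; lia.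
  (* The fresh root starts with arity 1; its [phi 1] occurs on both sides of the potential equation
     and cancels. *)
  have [] := @split_kid_spec h 0 (Node e [::] [:: t]) => //=.
  - by rewrite /arity /=; lia.
  - by case.
  set y' := split_kid _ _ => un' ar' pot'.
  exists 1, h.+1; rewrite !timeE /= /time_in /=.
  have wt := uniform_width unp; rewrite /= in wt.
  split; rewrite ?addn0 //.
  - by split=> //; rewrite /wf /goodp un' ar' /min_arity /arity /=; lia.
  - by rewrite /K /W; lia.
  have ph2 : phi 2 <= 3 by apply: phi_le3; lia.
  rewrite /arity /= in pot'; slia.
have [ctxq [ary szy iy gdy]] := ctx_cons ctxp.
rewrite /=; case: (leqP (arity _) mu.*2) => art.
  by apply: rebalanced_stop => //; rewrite /goodp unp art arp1.
have [] := split_kid_spec szy iy _ gdy unp; [lia|rewrite /= in arp2; lia|].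
set t1 := modify t q (split_kid i).
have nt1 : node_at t1 q = split_kid i (node_at t q) by rewrite node_at_modify.
rewrite -nt1 => un1 ar1 pot1.
have vq := ctx_valid ctxq.
have ctx1 : ctx h.+1 q t1 by apply: ctx_modify.
have sz1 : size (kids (node_at t1 q)) = arity (node_at t1 q).
  by move: un1; rewrite uniformS => /andP[/eqP].
have [v2 w2] : valid t1 (i :: q) /\ width (node_at t1 (i :: q)) <= W.
  by apply: ctx_kid_width un1 _ => //; rewrite sz1; lia.
have [v3 w3] : valid t1 (i.+1 :: q) /\ width (node_at t1 (i.+1 :: q)) <= W.
  by apply: ctx_kid_width un1 _ => //; rewrite sz1; lia.
set t2 := (repair_off_spine op t1 (i :: q)).2.
have s2 : sim t1 t2 by apply: repair_off_spine_sim.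
set t3 := (repair_off_spine op t2 (i.+1 :: q)).2.
have s3 : sim t1 t3.
  by apply: (sim_trans s2); apply: repair_off_spine_sim; rewrite -(sim_valid _ s2).
pose hit' := mark t3 (i :: q) (mark t3 (i.+1 :: q) hit).
have wp := uniform_width unp.
have wq : width (node_at t q) <= W by rewrite /width szy /W /arity in ary *; slia.
apply: (@rebalanced_step _ _ _ _ t3 _ (split_up op mu t3 q hit')) => //.
- by rewrite -(sim_anc q s3) anc_modify.
- rewrite -(sim_pot s3); have := pot_modify (split_kid i) vq.
  rewrite -/t1 -nt1; have := phiS (arity (node_at t q)); slia.
- apply: IHq; first exact: ctx_sim ctx1.
    by apply: sim_uniform un1; apply: sim_node_at.
  by rewrite -(sim_arity q s3) ar1; move: ary; rewrite /min_arity; case: nilp; slia.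
- by rewrite !timeE -/t2 -/t3 -/hit' /=; lia.
- rewrite !timeE -/t2 -/t3 -/hit' /=.
  have := repair_off_spine_time Rebalance t1 (i :: q).
  have := repair_off_spine_time Rebalance t2 (i.+1 :: q) => /=.
  rewrite /K; move: arp2 wp; rewrite /W /= in wq *; slia.
rewrite !timeE -/t2 -/t3 -/hit' /=.
have := repair_off_spine_time Repair t1 (i :: q).
have := repair_off_spine_time Repair t2 (i.+1 :: q).
rewrite -(sim_width _ s2) /K /=; move: w2 w3; rewrite /W /=; slia.
Qed.


(** The root is never handed on underfull: a merge that leaves it with arity 1 replaces it at once
    by its only child. Hence the two lower bounds in the hypothesis. *)
Lemma merge_up_spec h p t hit : ctx h p t -> uniform h (node_at t p) ->
  (if nilp p then min_arity true h else mu.-1) <= arity (node_at t p) <= mu.*2 ->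
  rebalanced h p t (merge_up op mu pick t p hit).
Proof.
elim: p h t hit => [|i q IHq] h t hit ctxp unp /andP[arp1 arp2].
  by apply: rebalanced_stop => //; rewrite /goodp unp arp2 arp1.
have [ctxq [ary szy iy gdy]] := ctx_cons ctxp; have vq := ctx_valid ctxq.
rewrite /=; case: (leqP mu (arity _)) => arp.
  by apply: rebalanced_stop => //; rewrite /goodp unp arp arp2.
have arpE : arity (node_at t (i :: q)) = mu.-1 by rewrite /= in arp1 *; slia.
set y := node_at t q in ary szy iy gdy *.
set left := (0 < i) && _; set l := if left then i.-1 else i.
(* A node with children has arity at least 2, even the root, so there is a sibling. [l] is the left
   one of the pair, and the underfull child is [l] or [l.+1]. *)
have ary2 : 2 <= arity y by move: ary; rewrite /min_arity; case: nilp; slia.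
have [ly il] : l.+1 < size (kids y) /\ (if left then i = l.+1 else i = l).
  rewrite /l; case: (boolP left); rewrite /left; last first.
    rewrite negb_and negb_or => H; split=> //; case/orP: H; first by lia.
    by case/andP; lia.
  by case/andP=> *; split; lia.
have gd j : j < size (kids y) -> j != l -> j != l.+1 ->
    good h (nth empty (kids y) j).
  by move=> jy jl jl1; apply: gdy => //; move: il; case: (left) => ->.
have ukid j : j < size (kids y) -> uniform h (nth empty (kids y) j).
  by have [-> //|ji jy] := eqVneq j i; have /andP[] := gdy j jy ji.
have u1 := ukid l (ltnW ly); have u2 := ukid l.+1 ly.
set sib := nth empty (kids y) (if left then l else l.+1).
have [arsib wsib] : mu <= arity sib <= mu.*2 /\ width sib <= W.
  have: good h sib by rewrite /sib; move: il; case: (left) => il; apply: gdy; lia.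
  by case/andP=> ar /uniform_width w; split=> //; move: w; rewrite /W; slia.
have wp : width (nth empty (kids y) i) <= W.
  by have := uniform_width unp; rewrite /= -/y /W in arp2 *; slia.
have wq : width y <= W by rewrite /width szy /W /arity in ary *; slia.
have kid_t1 f j : uniform h.+1 (f y) -> j < arity (f y) ->
    valid (modify t q f) (j :: q) /\
    width (node_at (modify t q f) (j :: q)) <= W.
  move=> unf jy; apply: (@ctx_kid_width h.+1); first exact: ctx_modify.
    by rewrite node_at_modify.
  by rewrite node_at_modify; move: unf; rewrite uniformS => /andP[/eqP-> _].
case: (leqP (arity sib) mu) => arsib2.
  have [|un1 ar1 pot1] := merge_kids_spec szy ly gd u1 u2.
    move: il arpE arsib arsib2; rewrite /= -/y /sib; case: (left) => ->; lia.
  set t1 := modify t q _.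
  have nt1 : node_at t1 q = merge_kids l y by rewrite node_at_modify.
  have pot_t1 : pot t1 < pot t.
    by have := pot_modify (merge_kids l) vq; rewrite -/t1 -/y; slia.
  (* The only remaining child becomes the root: the tree loses a level, and the potential 3 of the
     discarded node is released as well. *)
  case: ifP => [/andP[/nilP q0 /eqP art1]|not_root].
    rewrite /rebalanced /= !timeE /=.
    have : node_at t1 q = t1 by rewrite q0.
    rewrite nt1 => t1E; rewrite -t1E in art1 pot_t1 *.
    move: un1; rewrite uniformS art1 => /andP[/eqP sz1 gd1].
    move: pot_t1; rewrite potE art1 (phi_lt (a := 1)) // => pot_t1.
    case: (kids _) sz1 gd1 pot_t1 => [|z []] //= _ /andP[gdz _] pot_t1.
    have W_gt0 : 0 < W by rewrite /W; lia.
    exists 1, h; rewrite q0 /=; split=> //; try by rewrite /K; slia.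
    split=> //; last by slia.
    case/andP: gdz => arz unz; rewrite /wf /goodp unz andbT.
    by move: arz; rewrite /min_arity; case: (h) => *; slia.
  have [v2 w2] := kid_t1 _ l un1 ltac:(slia); rewrite -/t1 in v2 w2.
  set t2 := (repair_off_spine op t1 (l :: q)).2.
  have s2 : sim t1 t2 by apply: repair_off_spine_sim.
  pose hit' := mark t2 (l :: q) hit.
  have ta := repair_off_spine_time Rebalance t1 (l :: q).
  have tb := repair_off_spine_time Repair t1 (l :: q).
  apply: (@rebalanced_step _ _ _ _ t2 _ (merge_up op mu pick t2 q hit')) => //.
  - by rewrite -(sim_anc q s2) anc_modify.
  - by rewrite -(sim_pot s2).
  - apply: IHq; first by apply: ctx_sim s2 _; apply: ctx_modify.
      by apply: sim_uniform (sim_node_at q s2) _; rewrite nt1.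
    have not1 : nilp q -> (arity y).-1 != 1.
      by move=> /nilP q0; move: not_root; rewrite -ar1 -nt1 q0 /= => ->.
    rewrite -(sim_arity q s2) nt1 ar1; move: ary not1; rewrite /min_arity.
    by case: nilp => ? not1; [have := not1 isT|]; slia.
  - by rewrite !timeE -/t2 -/hit' /=; slia.
  - by rewrite !timeE -/t2 -/hit' /= /K; rewrite /= in ta; rewrite /W in wp wq wsib *; slia.
  - by rewrite !timeE -/t2 -/hit' /= /K; rewrite /= in tb w2; rewrite /W in w2 *; slia.
set mv := if left then _ else _.
have [un1 ar1 pot1] : [/\ uniform h.+1 (mv y), arity (mv y) = arity y
    & pot (mv y) < pot y].
  move: il arpE arsib arsib2; rewrite /mv /= -/y /sib.
  case: (left) => -> *.
    by apply: move_rightwards_spec => //; slia.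
  by apply: move_leftwards_spec => //; slia.
set t1 := modify t q _.
have nt1 : node_at t1 q = mv y by rewrite node_at_modify.
have pot_t1 : pot t1 < pot t.
  by have := pot_modify mv vq; rewrite -/t1 -/y; slia.
have [v2 w2] := kid_t1 _ l un1 ltac:(slia).
have [v3 w3] := kid_t1 _ l.+1 un1 ltac:(slia); rewrite -/t1 in v2 w2 v3 w3.
set t2 := (repair_off_spine op t1 (l :: q)).2.
have s2 : sim t1 t2 by apply: repair_off_spine_sim.
set t3 := (repair_off_spine op t2 (l.+1 :: q)).2.
have s3 : sim t1 t3.
  by apply: (sim_trans s2); apply: repair_off_spine_sim; rewrite -(sim_valid _ s2).
pose hit' := mark t3 (l :: q) (mark t3 (l.+1 :: q) hit).
have ta := repair_off_spine_time Rebalance t1 (l :: q).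
have tb := repair_off_spine_time Rebalance t2 (l.+1 :: q).
have tc := repair_off_spine_time Repair t1 (l :: q).
have td := repair_off_spine_time Repair t2 (l.+1 :: q).
apply: (@rebalanced_step _ _ _ _ t3 _ (merge_up op mu pick t3 q hit')) => //.
- by rewrite -(sim_anc q s3) anc_modify.
- by rewrite -(sim_pot s3).
- apply: IHq; first by apply: ctx_sim s3 _; apply: ctx_modify.
    by apply: sim_uniform (sim_node_at q s3) _; rewrite nt1.
  by rewrite -(sim_arity q s3) nt1 ar1; move: ary; rewrite /min_arity; case: nilp; slia.
- by rewrite !timeE -/t2 -/t3 -/hit' /=; slia.
- by rewrite !timeE -/t2 -/t3 -/hit' /= /K; rewrite /= in ta tb; rewrite /W in wp wq wsib *; slia.
rewrite !timeE -/t2 -/t3 -/hit' /= /K; rewrite -(sim_width _ s2) in td.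
by rewrite /= /W in tc td w2 w3 *; slia.
Qed.


(** * Repair *)

(** The third clause makes [s] the lowest spine ancestor of [q]; comparing it with the node where
    the search left the spine bounds the walk up and the walk down. *)
Lemma repair_up_spec H t q : wf H t -> valid t q ->
  let r := repair_up op t q in let s := r.2.2 in
  [/\ sim t r.2.1, suffix s q,
      forall c : addr, suffix c q -> on_spine t c -> size c <= size s
    & time_in Repair r <= W.+1 * (size q - size s)].
Proof.
elim: q t => [|i q IHq] t wft vq; cbv zeta.
  by rewrite suffix_refl; split=> // c; rewrite suffixs0 => /eqP->.
have -> : repair_up op t (i :: q) = if on_spine t (i :: q) then ret (t, i :: q)
  else bind (repair_node op t (i :: q)) (fun t1 => repair_up op t1 q) by [].
case: ifP => spq.
  rewrite suffix_refl; split=> // c sc _; exact: size_suffix sc.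
have s1 := repair_node_sim vq; rewrite time_in_bind bind_res.
set t1 := (repair_node op t (i :: q)).2 in s1 *.
have vq1 : valid t1 q by rewrite -(sim_valid _ s1); case/andP: vq.
have [s2 sq spc tm] := IHq _ (sim_goodp s1 wft) vq1.
split.
- exact: sim_trans s1 s2.
- exact: suffix_trans sq (suffix_cons _ _).
- move=> c /suffix_consr[->|sc]; first by rewrite spq.
  rewrite (@on_spine_anc _ t1 _ c) ?suffix_refl ?(sim_anc c s1) //; exact: spc.
rewrite repair_node_time /=; have /= := wf_width wft vq; have := size_suffix sq.
by move=> *; rewrite subSn // mulnS; slia.
Qed.

Lemma repair_spine_spec H right h t p : wf H t -> valid t p ->
  let r := repair_spine op right h t p in
  sim t r.2 /\ time_in Repair r <= W.+1 * (H - size p).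
Proof.
elim: h t p => [|h IHh] t p wft vp; cbv zeta; first by rewrite /=; case: ifP.
pose p' := (if right then (size (kids (node_at t p))).-1 else 0) :: p.
have -> : repair_spine op right h.+1 t p = if is_leaf (node_at t p) then ret t
  else bind (repair_node op t p') (fun t1 => repair_spine op right h t1 p').
  by [].
case: ifP => // leafp; have vp' : valid t p'.
  move: leafp; rewrite /p' /= vp /is_leaf /nilp; case: right {IHh p'}; lia.
have s1 := repair_node_sim vp'; rewrite time_in_bind bind_res.
set t1 := (repair_node op t p').2 in s1 *.
have [|s2 tm] := IHh _ p' (sim_goodp s1 wft); first by rewrite -(sim_valid _ s1).
split; first exact: sim_trans s1 s2.
rewrite repair_node_time /=.
have /= := wf_width wft vp'; have /= lt := wf_valid_size wft vp'.
by move: tm => /= tm w; rewrite -(subnSK lt) mulnS; slia.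
Qed.

(** The doubled term covers the case that [top] is the root, below which both spines may have to be
    repaired. *)
Lemma repair_spec H t p0 q (l : addr) hit :
  wf H t -> valid t q -> suffix q l -> suffix p0 l ->
  let r := repair op t p0 q hit in
  sim t r.2 /\ exists s : addr, let top := if size p0 < size s then p0 else s in
  [/\ suffix s q, forall c : addr, suffix c q -> on_spine t c -> size c <= size s
    & time_in Repair r <= W.+1 * ((size q - size s).+1 + (H - size top).*2)].
Proof.
move=> wft vq sq sp0; have := repair_up_spec wft vq; cbv zeta.
rewrite /repair time_in_bind bind_res.
move: (time_in Repair (repair_up op t q)) => T1.
case: (repair_up op t q).2 => t1 s [/= s1 /= ss /= spc /= tm1].
cbv iota beta; set top := if size p0 < size s then p0 else s.
rewrite !time_in_bind !bind_res.
have vtop : valid t top.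
  apply: valid_suffix vq; rewrite /top; case: ltnP => // lts.
  apply: (suffix_trans _ ss); apply: suffix_comparable sp0 _ (ltnW lts).
  exact: suffix_trans ss sq.
have wft1 := sim_goodp s1 wft.
have vtop1 : valid t1 top by rewrite -(sim_valid _ s1).
have s2 := sim_trans s1 (repair_node_sim vtop1).
have w2 := wf_width wft1 vtop1.
set t2 := (repair_node op t1 top).2 in s2 *.
set m := if on_left top || _ then _ else _.
have [s3 tm3] : sim t m.2 /\ time_in Repair m <= W.+1 * (H - size top).
  rewrite /m; case: ifP => // _.
  have vtop2 : valid t2 top by rewrite -(sim_valid _ s2).
  have [s3 tm3] := repair_spine_spec false (height t2) (sim_goodp s2 wft) vtop2.
  by split=> //; apply: sim_trans s2 s3.
set m' := if on_right m.2 top || _ then _ else _.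
have [s4 tm4] : sim t m'.2 /\ time_in Repair m' <= W.+1 * (H - size top).
  rewrite /m'; case: ifP => // _.
  have vtop3 : valid m.2 top by rewrite -(sim_valid _ s3).
  have [s4 tm4] := repair_spine_spec true (height m.2) (sim_goodp s3 wft) vtop3.
  by split=> //; apply: sim_trans s3 s4.
split=> //; exists s; split=> //; rewrite -/top !timeE /=.
by rewrite mulnDr mulnS -muln2 mulnA; slia.
Qed.

(** * Phases to which repair and rebalancing charge nothing *)

Lemma repair_node_phase ph t p : ph != Repair ->
  time_in ph (repair_node op t p) = 0.
Proof. by rewrite repair_node_time => /negbTE->. Qed.

Lemma repair_off_spine_phase ph t p : ph != Repair ->
  time_in ph (repair_off_spine op t p) = 0.
Proof.
move/negbTE=> phR; apply/eqP; rewrite -leqn0.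
by have := repair_off_spine_time ph t p; rewrite phR.
Qed.

Lemma repair_up_phase ph t p : ph != Repair -> time_in ph (repair_up op t p) = 0.
Proof.
move=> phR; elim: p t => //= i p IHp t; case: ifP => // _.
by rewrite time_in_bind repair_node_phase // IHp.
Qed.

Lemma repair_spine_phase ph b h t p : ph != Repair ->
  time_in ph (repair_spine op b h t p) = 0.
Proof.
move=> phR; elim: h t p => //= [|h IHh] t p; case: ifP => // _.
by rewrite time_in_bind repair_node_phase // IHh.
Qed.

Lemma repair_phase ph t p q hit : ph != Repair ->
  time_in ph (repair op t p q hit) = 0.
Proof.
move=> phR; rewrite /repair time_in_bind repair_up_phase //.
case: (repair_up op t q).2 => t1 s; rewrite time_in_bind repair_node_phase // time_in_bind.
by rewrite !(fun_if (time_in ph)) !repair_spine_phase // !time_in_ret !if_same.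
Qed.

Lemma split_up_phase ph t p hit : ph != Rebalance -> ph != Repair ->
  time_in ph (split_up op mu t p hit) = 0.
Proof.
move=> phB phR; elim: p t hit => [|i q IHq] t hit /=;
  rewrite time_in_bind time_in_tick (negbTE phB); case: ifP => // _;
  by rewrite !timeE (negbTE phB) ?repair_off_spine_phase ?IHq.
Qed.

Lemma merge_up_phase ph t p hit : ph != Rebalance -> ph != Repair ->
  time_in ph (merge_up op mu pick t p hit) = 0.
Proof.
move=> phB phR; elim: p t hit => [|i q IHq] t hit /=;
  rewrite time_in_bind time_in_tick (negbTE phB) //; case: ifP => // _.
rewrite time_in_bind time_in_tick (negbTE phB); case: ifP => _.
  by case: ifP => _ //; rewrite time_in_bind repair_off_spine_phase ?IHq.
by rewrite !time_in_bind !repair_off_spine_phase ?IHq.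
Qed.

(** * Search *)

(** [cov] is tested at the parent before moving there, so a walk that has moved at all ends at a
    node where the test failed. The lower bound on the time is what later lets repair be charged to
    the search. *)
Lemma climb_spec cov t p : let r := climb cov t p in
  [/\ suffix r.2 p,
      r.2 != p -> exists2 i, suffix (i :: r.2) p & ~~ cov (node_at t r.2)
    & (size p - size r.2).*2 <= time_in Search r <= (size p - size r.2).+1.*2].
Proof.
elim: p => [|i p /= [sp nc tm]]; first by [].
case: ifP => [_|ncov].
  by rewrite timeE /= suffix_refl eqxx subnn !timeE.
split.
- exact: suffix_trans sp (suffix_cons _ _).
- move=> _ /=; have [eqp|/nc[j sj ncj]] := eqVneq (climb cov t p).2 p.
    by exists i; rewrite ?eqp ?suffix_refl ?ncov.
  by exists j => //; apply: suffix_trans sj (suffix_cons _ _).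
by rewrite time_in_bind time_in_tick /= subSn ?(size_suffix sp) //; slia.
Qed.

Lemma climb_phase ph cov t p : ph != Search -> time_in ph (climb cov t p) = 0.
Proof.
move=> phS; elim: p => //= i p IHp; rewrite time_in_bind time_in_tick.
by rewrite (negbTE phS); case: ifP.
Qed.

Lemma wf_kids H t p : wf H t -> valid t p -> ~~ is_leaf (node_at t p) ->
  size (kids (node_at t p)) = arity (node_at t p).
Proof.
move=> wft vp; have [_ /andP[_]] := wf_node_at wft vp.
case: (H - size p) => [|h]; first by rewrite uniform0 /is_leaf => ->.
by rewrite uniformS => /andP[/eqP].
Qed.

Lemma descend_spec H h tm t p : wf H t -> valid t p -> H - size p <= h ->
  let r := descend h tm t p in
  [/\ valid t r.2, suffix p r.2,
      has_time tm (node_at t r.2) || is_leaf (node_at t r.2)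
    & time_in Search r <= W * (size r.2 - size p).+1].
Proof.
move=> wft; elim: h p => [|h IHh] p vp leh; have wp := wf_width wft vp;
  have lep := wf_valid_size wft vp; rewrite /= !time_in_bind time_in_tick /=.
  have lfp : is_leaf (node_at t p) by rewrite (wf_leaf wft); lia.
  by rewrite lfp orbT /= suffix_refl subnn muln1 vp lfp orbT timeE addn0.
case: ifP => [-> /=|/norP[_ nlf]].
  by rewrite suffix_refl subnn muln1 vp timeE addn0.
set p' := _ :: p; have vp' : valid t p'.
  rewrite /= vp (wf_kids wft vp nlf) ltnS /=; exact: find_size.
have [|v sp' stop tmr] := IHh p' vp'; first by rewrite /=; lia.
split=> //; first exact: suffix_trans (suffix_cons _ _) sp'.
have /= := size_suffix sp'; move: tmr; rewrite /= => tmr lt.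
by rewrite (subnSK lt) in tmr; rewrite mulnS; slia.
Qed.


Lemma descend_phase ph h tm t p : ph != Search ->
  time_in ph (descend h tm t p) = 0.
Proof.
move=> phS; elim: h p => [|h IHh] p /=;
  by rewrite time_in_bind time_in_tick (negbTE phS); case: ifP => _ //; apply: IHh.
Qed.

Lemma left_finger_spec H t : wf H t -> let p := left_finger t in
  [/\ valid t p, size p = H & on_spine t p].
Proof.
move=> wft; have /andP[_ un] := wft.
rewrite /left_finger (uniform_height un) /= size_nseq; split=> //.
  suff: forall n, n <= H -> valid t (nseq n 0) by apply.
  elim=> //= n IHn ltn; have vn := IHn (ltnW ltn); rewrite vn /=.
  have := wf_leaf wft vn; rewrite size_nseq /is_leaf /nilp; lia.
rewrite /Defs.on_spine /on_left; case: (H) => //= n.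
by rewrite all_pred1_nseq.
Qed.

Lemma last_path_spec h y : uniform h y ->
  [/\ valid y (rev (last_path y)), size (last_path y) = h
    & all_last y (rev (last_path y))].
Proof.
elim: h y => [|h IHh] [a es zs].
  by rewrite uniform0 => /nilP /= ->.
rewrite uniformS /arity /= => /andP[/eqP sz gd].
have zsE : nilp zs = false by rewrite /nilp sz.
rewrite zsE rev_cons -cats1 valid_cat all_last_cat /=.
have -> : last [::] [seq last_path z | z <- zs] =
    last_path (nth empty zs (size zs).-1).
  rewrite nth_last; case: (zs) sz => //= z zs' _.
  by rewrite -[last_path z]/(last_path z) last_map.
have lt : (size zs).-1 < size zs by rewrite sz.
have /andP[_ /IHh[-> -> ->]] := all_nthP empty gd _ lt.
by rewrite lt sz eqxx.
Qed.

Lemma right_finger_spec H t : wf H t -> let p := right_finger t in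
  [/\ valid t p, size p = H & on_spine t p].
Proof.
move=> wft; have /andP[_ /last_path_spec[v sz al]] := wft.
rewrite /= /Defs.on_spine /Defs.on_right /right_finger size_rev v sz al.
by case: nilp; rewrite ?orbT.
Qed.

(** The first half of [search], named because all later bounds are relative to the level of the node
    where it ends. *)
Definition climbed tm t : run addr :=
  if after tm t then climb (after tm) t (right_finger t)
  else climb (before tm) t (left_finger t).

Lemma climbed_spec H tm t : wf H t -> let r := climbed tm t in
  [/\ valid t r.2, on_spine t r.2
    & (H - size r.2).*2 <= time_in Search r <= (H - size r.2).+1.*2].
Proof.
move=> wft; rewrite /= /climbed.
have [vl sl spl] := left_finger_spec wft.
have [vr sr spr] := right_finger_spec wft.
case: ifP => _; last first.
  have [sc _] := climb_spec (before tm) t (left_finger t); rewrite sl.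
  by split=> //; [apply: valid_suffix vl | apply: on_spine_suffix spl].
have [sc _] := climb_spec (after tm) t (right_finger t); rewrite sr.
by split=> //; [apply: valid_suffix vr | apply: on_spine_suffix spr].
Qed.

Lemma W_ge : 12 <= W. Proof. by rewrite /W; lia. Qed.

Lemma search_spec H tm t : wf H t ->
  let r := search tm t in let c := (climbed tm t).2 in
  [/\ suffix c r.2, valid t r.2,
      has_time tm (node_at t r.2) || is_leaf (node_at t r.2)
    & H - size c < time_in Search r <= W.*2 * (H - size c).+1].
Proof.
move=> wft; have [vc spc tmc] := climbed_spec tm wft; cbv zeta.
have -> : search tm t = bind (tick Search 2) (fun=> bind (climbed tm t)
  (fun p => descend (height t) tm t p)) by [].
have /andP[_ /uniform_height ->] := wft.
rewrite !bind_res !time_in_bind time_in_tick /=.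
set c := (climbed tm t).2 in vc spc tmc *.
have [vr sr hr tmr] := descend_spec tm wft vc (leq_subr _ _).
split=> //; have szr := wf_valid_size wft vr; have W_ge12 := W_ge.
set r := (descend H tm t c).2 in szr tmr *.
have : W * (size r - size c).+1 <= W * (H - size c).+1 by rewrite leq_mul2l; lia.
rewrite -muln2 -mulnA [2 * _]mulnC mulnA.
have : 12 * (H - size c).+1 <= W * (H - size c).+1 by rewrite leq_mul2r W_ge12 orbT.
by slia.
Qed.

Lemma search_phase ph tm t : ph != Search -> time_in ph (search tm t) = 0.
Proof.
move=> phS; rewrite /search !time_in_bind time_in_tick (negbTE phS).
by rewrite (fun_if (time_in ph)) !climb_phase // if_same descend_phase.
Qed.

Lemma first_leaf_spec H h t p : wf H t -> valid t p -> H - size p <= h ->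
  let r := first_leaf h t p in
  [/\ valid t r.2, suffix p r.2, is_leaf (node_at t r.2)
    & time_in Search r <= (H - size p).+1].
Proof.
move=> wft; elim: h p => [|h IHh] p vp leh;
  have lfp := wf_leaf wft vp; have lep := wf_valid_size wft vp;
  rewrite /= time_in_bind time_in_tick /=.
  have leaf : is_leaf (node_at t p) by rewrite lfp; slia.
  by rewrite leaf /= vp suffix_refl leaf.
case: ifP => [leaf|nlf]; first by rewrite leaf vp suffix_refl.
have vp' : valid t (0 :: p) by move: nlf; rewrite /= vp /is_leaf /nilp; lia.
have lep' := wf_valid_size wft vp'.
have [|v sp' leaf tmr] := IHh (0 :: p) vp'; first by rewrite /=; lia.
split=> //; first exact: suffix_trans (suffix_cons _ _) sp'.
by rewrite /= in lep' tmr; slia.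
Qed.

Lemma last_leaf_spec H h t p : wf H t -> valid t p -> H - size p <= h ->
  let r := last_leaf h t p in
  [/\ valid t r.2, suffix p r.2, is_leaf (node_at t r.2)
    & time_in Search r <= (H - size p).+1].
Proof.
move=> wft; elim: h p => [|h IHh] p vp leh;
  have lfp := wf_leaf wft vp; have lep := wf_valid_size wft vp;
  rewrite /= time_in_bind time_in_tick /=.
  have leaf : is_leaf (node_at t p) by rewrite lfp; slia.
  by rewrite leaf /= vp suffix_refl leaf.
case: ifP => [leaf|nlf]; first by rewrite leaf vp suffix_refl.
set p' := _ :: p; have vp' : valid t p'.
  by move: nlf; rewrite /= vp /is_leaf /nilp; lia.
have lep' := wf_valid_size wft vp'.
have [|v sp' leaf tmr] := IHh p' vp'; first by rewrite /=; lia.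
split=> //; first exact: suffix_trans (suffix_cons _ _) sp'.
by rewrite /= in lep' tmr; slia.
Qed.

Lemma first_leaf_phase ph h t p : ph != Search ->
  time_in ph (first_leaf h t p) = 0.
Proof.
move=> phS; elim: h p => [|h IHh] p /=;
  by rewrite time_in_bind time_in_tick (negbTE phS); case: ifP => _ //; apply: IHh.
Qed.

Lemma last_leaf_phase ph h t p : ph != Search ->
  time_in ph (last_leaf h t p) = 0.
Proof.
move=> phS; elim: h p => [|h IHh] p /=;
  by rewrite time_in_bind time_in_tick (negbTE phS); case: ifP => _ //; apply: IHh.
Qed.

(** * Updates *)

Lemma insert_at_phase ph tm v t p : ph != Search ->
  time_in ph (insert_at op tm v t p) = 0.
Proof. by move=> phS; rewrite /insert_at !timeE (negbTE phS). Qed.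

Lemma evict_at_phase ph j t p : ph != Search ->
  time_in ph (evict_at mu j t p) = 0.
Proof.
move=> phS; rewrite /evict_at; case: ifP => _.
  by rewrite !timeE (negbTE phS).
by case: ifP => _; rewrite time_in_bind ?first_leaf_phase ?last_leaf_phase //
  !timeE (negbTE phS).
Qed.

(** Combining with an existing entry changes no counts. A new entry is only ever added to a leaf,
    and having no children a leaf stays uniform with one entry more. *)
Lemma insert_at_spec H tm v t p : wf H t -> valid t p ->
  has_time tm (node_at t p) || is_leaf (node_at t p) ->
  let r := insert_at op tm v t p in let h := H - size p in
  [/\ ctx h p r.2 /\ anc r.2 p = anc t p, uniform h (node_at r.2 p),
      min_arity (nilp p) h <= arity (node_at r.2 p) <= mu.*2.+1,
      pot r.2 <= pot t + 3 & time_in Search r <= W].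
Proof.
move=> wft vp stop; have [ctxp /andP[arp unp]] := wf_node_at wft vp; cbv zeta.
rewrite /insert_at; set es' := if has_time _ _ then _ else _.
rewrite bind_res !timeE /= addn0 (wf_width wft vp) node_at_modify.
have := pot_modify (with_ents es') vp.
set y := node_at t p in stop arp unp es' *.
set j := slot tm y in es' *.
rewrite [pot (with_ents _ _)]potE /= [pot y]potE.
rewrite /arity /= in arp *.
case hty: (has_time tm y) in es' stop *.
  have szes' : size es' = size (ents y).
    rewrite /es' -[in RHS](cat_take_drop j (ents y)).
    rewrite -[in RHS](cat_take_drop 1 (drop j (ents y))) drop_drop add1n.
    by rewrite !size_cat size_map.
  rewrite szes' /arity => pt; split=> //; try lia.
  - by split; [apply: ctx_modify | apply: anc_modify].
  - by apply: sim_uniform unp; apply: sim_node.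
have szes' : size es' = (size (ents y)).+1.
  rewrite /es' -[in RHS](cat_take_drop j (ents y)).
  by rewrite !size_cat /= addnS.
have /eqP szp : size p == H by rewrite -(wf_leaf wft vp).
rewrite szes' /arity => pt; split=> //; try lia.
- by split; [apply: ctx_modify | apply: anc_modify].
- by move: unp; rewrite szp subnn !uniform0.
by have := phiS (size (ents y)).+1; lia.
Qed.

Lemma modify_cat t p q f :
  modify t (p ++ q) f = modify t q (fun y => modify y p f).
Proof. by elim: p f => //= i p IHp f; rewrite IHp. Qed.

Lemma ents_modify t p f : ~~ nilp p -> ents (modify t p f) = ents t.
Proof. by elim: p f => //= i [|j p] IHp f _ //; rewrite IHp. Qed.

Lemma size_put j xs y : j < size (ents y) ->
  size (ents (put j xs y)) = (size (ents y)).-1 + size xs.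
Proof.
move=> jy; rewrite /put /= !size_cat size_drop size_takel; last exact: ltnW.
by lia.
Qed.

(* [t1] is [t] with one entry less in the leaf [l]. *)
Definition evicted h l t t1 :=
  [/\ ctx h l t1 /\ anc t1 l = anc t l, uniform h (node_at t1 l),
      (if nilp l then min_arity true h else mu.-1) <= arity (node_at t1 l) <= mu.*2
    & pot t1 <= pot t + 2].

Lemma evict_leaf H t l k : wf H t -> valid t l -> is_leaf (node_at t l) ->
  k < size (ents (node_at t l)) ->
  evicted (H - size l) l t (modify t l (put k [::])).
Proof.
move=> wft vl leafl kl; have [ctxl /andP[arl unl]] := wf_node_at wft vl.
have /eqP szl : size l == H by rewrite -(wf_leaf wft vl).
rewrite szl subnn in arl unl ctxl *; rewrite /evicted node_at_modify.
rewrite anc_modify // /arity size_put // addn0; split.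
- by split=> //; apply: ctx_modify.
- by move: unl; rewrite !uniform0.
- by move: arl; rewrite /min_arity /arity; case: nilp; slia.
have := pot_modify (put k [::]) vl; rewrite !potE /arity size_put // addn0 /=.
by have := phi_pred (size (ents (node_at t l))).-1.+1; rewrite prednK; slia.
Qed.

(** Writing the substitute over the evicted entry trades one entry for one, so the loss in the leaf
    remains the only change of shape. As [l] lies strictly below [p], the entries of [p] are still
    those of [t] when this happens. *)
Lemma evicted_swap h t t0 l p j xs : suffix p l -> p != l ->
  j < size (ents (node_at t p)) -> size xs = 1 -> forall k,
  t0 = modify t l (put k [::]) -> evicted h l t t0 ->
  evicted h l t (modify t0 p (put j xs)).
Proof.
move=> spl npl jp szx k t0E [[ctxl ancl] unl arl potl].
have jp0 : j < size (ents (node_at t0 p)).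
  rewrite t0E; case/suffixP: spl npl => -[|i d] ->; first by rewrite eqxx.
  by rewrite modify_cat node_at_modify ents_modify.
have s : sim t0 (modify t0 p (put j xs)).
  apply: sim_modify; first exact: valid_suffix spl (ctx_valid ctxl).
  by apply: sim_node => //; rewrite size_put // szx; slia.
split.
- by split; [apply: ctx_sim s ctxl | rewrite -(sim_anc l s)].
- by apply: sim_uniform (sim_node_at l s) unl.
- by rewrite -(sim_arity l s).
by rewrite -(sim_pot s).
Qed.


Lemma evict_at_spec H j t p : wf H t -> valid t p ->
  j < size (ents (node_at t p)) ->
  let r := evict_at mu j t p in
  [/\ valid t r.2.2, suffix p r.2.2, evicted (H - size r.2.2) r.2.2 t r.2.1
    & time_in Search r <= W.*2 + (H - size p)].
Proof.
move=> wft vp jp; have wp := wf_width wft vp; cbv zeta; rewrite /evict_at.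
have /andP[_ /uniform_height ->] := wft.
case: ifP => leafp.
  rewrite bind_res !timeE /= vp suffix_refl addn0.
  by split=> //; [apply: evict_leaf | slia].
have szp : size (kids (node_at t p)) = (size (ents (node_at t p))).+1.
  by rewrite (wf_kids wft vp) ?leafp.
(* A leaf other than the root has arity at least [mu], hence an entry to give away. *)
have szents l : valid t l -> is_leaf (node_at t l) -> ~~ nilp l ->
    0 < size (ents (node_at t l)).
  move=> vl _ nl; have [_ /andP[/andP[+ _] _]] := wf_node_at wft vl.
  by rewrite (negbTE nl) /arity /min_arity; slia.
have ltp i : i < size (kids (node_at t p)) -> H - size (i :: p) < H - size p.
  move=> ip; have vip : valid t (i :: p) by rewrite /= vp.
  by have := wf_valid_size wft vip; rewrite /=; slia.
have step l i : suffix (i :: p) l -> suffix p l /\ p != l /\ ~~ nilp l.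
  move=> sl; have := size_suffix sl => /= ltl; split.
    exact: suffix_trans (suffix_cons _ _) sl.
  split; last by case: (l) ltl.
  by apply: contraTneq ltl => <-; rewrite ltnn.
case: ifP => _; rewrite !bind_res !time_in_bind /= timeE /=.
  have vj : valid t (j.+1 :: p) by rewrite /= vp szp ltnS.
  have [|vl sl leafl tml] := first_leaf_spec wft vj (h := H); first exact: leq_subr.
  set l := (first_leaf H t (j.+1 :: p)).2 in vl sl leafl *.
  have [spl [npl nl]] := step _ _ sl; have el := szents l vl leafl nl.
  split=> //.
    apply: (evicted_swap spl npl jp _ erefl); last exact: evict_leaf.
    by rewrite size_take; case: (size _) el => [|[]].
  have := ltp j.+1; have := wf_width wft vl; rewrite szp ltnS => wl /(_ jp).
  by rewrite time_in_ret; have := W_ge; move: tml; slia.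
have vj : valid t (j :: p) by rewrite /= vp szp ltnS ltnW.
have [|vl sl leafl tml] := last_leaf_spec wft vj (h := H); first exact: leq_subr.
set l := (last_leaf H t (j :: p)).2 in vl sl leafl *.
have [spl [npl nl]] := step _ _ sl; have el := szents l vl leafl nl.
split=> //.
  apply: (evicted_swap spl npl jp _ erefl); last by apply: evict_leaf => //; slia.
  by rewrite size_drop; slia.
have := ltp j; have := wf_width wft vl; rewrite szp ltnS => wl /(_ (ltnW jp)).
by rewrite time_in_ret; have := W_ge; move: tml; slia.
Qed.

Definition finish p0 (rb : run (tree T S * addr * hits)) : run (tree T S) :=
  let* (t2, q, hit) := rb in repair op t2 p0 q hit.

(** [c], [p0] and [l] are nested ancestors: where the search left the spine, where it ended, and
    where rebalancing starts. Scaling the potential by [K] lets each unit released pay for one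
    rebalancing step. *)
Lemma finish_spec H t t1 (c p0 l : addr) rb :
  wf H t -> valid t l -> suffix c p0 -> suffix p0 l -> on_spine t c ->
  anc t1 l = anc t l -> pot t1 <= pot t + 3 -> rebalanced (H - size l) l t1 rb ->
  let r := finish p0 rb in
  [/\ exists H', wf H' r.2, time_in Rebalance r <= K * H.+2,
      time_in Repair r <= K.*2 * (H - size c + time_in Rebalance r).+1
    & time_in Rebalance r + K * pot r.2 <= K * pot t + 4 * K].
Proof.
move=> wft vl scp spl spc anct1 pott1 []; rewrite /finish; cbv zeta.
rewrite !time_in_bind bind_res.
move: (time_in Rebalance rb) (time_in Repair rb) => TB TR.
case: (rb.2) => -[t2 q] hit /= n.
case=> H' [[wft2 leH' vq sql ancq] [n1 n2] /andP[n3 n4] n5 n6].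
rewrite repair_phase // addn0.
have [s4 [s [ssq spq tm]]] := repair_spec hit wft2 vq sql spl.
have lel := wf_valid_size wft vl; rewrite subnK // in leH'.
(* [spc] speaks of [t] but [repair] tests membership in [t2]; equal child counts above [q] bridge
   the two. *)
have anc2 : anc t2 q = anc t q.
  case/suffixP: sql anct1 ancq => d ->; rewrite !anc_cat.
  by move/(congr1 (drop (size d))); rewrite !drop_size_cat ?size_anc // => ->.
have scl := suffix_trans scp spl.
have [z1 z2 z3 z4] : [/\ size c <= size p0, size p0 <= size l, size s <= size q
    & size q <= size l] by split; apply: size_suffix.
have W_ge12 := W_ge.
split.
- by exists H'; apply: sim_goodp s4 wft2.
- by apply: leq_trans n4 _; rewrite leq_mul2l; slia.
- set top := if _ then p0 else s in tm.
  (* If [c] is an ancestor of [q], then [s] and [top] are at or below [c]. Otherwise [q] is above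
     [c], hence on the spine, so [s] is [q], and the levels between [l] and [q] took at least one
     rebalancing step each. The successor allows for the height having grown by one. *)
  have [a1 a2] : size q - size s <= H - size c /\
                 H' - size top <= (H - size c + TB).+1.
    case: (leqP (size c) (size q)) => leq.
      have scq : suffix c q by apply: suffix_comparable scl sql leq.
      have := spq c scq; rewrite (on_spine_anc scq anc2) => /(_ spc) les.
      by rewrite /top; case: ltnP => ?; slia.
    have sqc : suffix q c by apply: suffix_comparable sql scl (ltnW leq).
    have := spq q (suffix_refl _).
    rewrite (on_spine_anc (suffix_refl _) anc2) (on_spine_suffix sqc) //.
    by move=> /(_ isT) les; rewrite /top; case: ltnP => ?; slia.
  set k := H - size c in a1 a2 *.
  have tm' : time_in Repair (repair op t2 p0 q hit) <= W.+1 * (3 * (k + TB).+1).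
    by apply: leq_trans tm _; rewrite leq_mul2l; slia.
  have n5' : TR <= K * TB by apply: leq_trans n5 _; rewrite leq_mul2l n3 orbT.
  have K4 : 3 * W.+1 <= K by rewrite /K; slia.
  have tm'' : W.+1 * (3 * (k + TB).+1) <= K * (k + TB).+1.
    by rewrite mulnA leq_mul2r [W.+1 * 3]mulnC K4 orbT.
  have : K * TB <= K * (k + TB).+1 by rewrite leq_mul2l; slia.
  by rewrite -muln2 -mulnA [2 * _]mulnC mulnA; slia.
rewrite -(sim_pot s4).
(* Of the [4 * K], three parts pay for the potential added by the update, and one for the final test
   that stops rebalancing. *)
have : K * (n + pot t2) <= K * (pot t + 3).
  by rewrite leq_mul2l; apply/orP; right; slia.
move: n4 {tm}; rewrite mulnS !(mulnDr K) [4 * K]mulnC.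
move: (K * n) (K * pot t2) (K * pot t) K => a b c' d; slia.
Qed.

Lemma insert_spec H tm v t : wf H t ->
  let r := insert op mu tm v t in let k := H - size (climbed tm t).2 in
  [/\ exists H', wf H' r.2,
      k < time_in Search r <= 5 * W * k.+1,
      time_in Rebalance r <= K * H.+2,
      time_in Repair r <= K.*2 * (k + time_in Rebalance r).+1
    & time_in Rebalance r + K * pot r.2 <= K * pot t + 4 * K].
Proof.
move=> wft; have [scp vp stop tms] := search_spec tm wft.
have [vc spc _] := climbed_spec tm wft.
cbv zeta; rewrite /insert; set p := (search tm t).2 in scp vp stop *.
rewrite ![time_in _ (bind (search tm t) _)]time_in_bind.
rewrite [(bind (search tm t) _).2]bind_res -/p.
rewrite !(@search_phase Rebalance) // !(@search_phase Repair) //.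
have [[ctx1 anc1] un1 ar1 pot1 tm1] := insert_at_spec v wft vp stop.
rewrite ![time_in _ (bind (insert_at op tm v t p) _)]time_in_bind.
rewrite [(bind (insert_at op tm v t p) _).2]bind_res.
rewrite !(@insert_at_phase Rebalance) // !(@insert_at_phase Repair) //.
set t1 := (insert_at op tm v t p).2 in ctx1 anc1 un1 ar1 pot1 *.
set rb := split_up _ _ _ _ _.
rewrite -/(finish p rb).
have rbP : rebalanced (H - size p) p t1 rb by apply: split_up_spec.
have [] := finish_spec wft vp scp (suffix_refl _) spc anc1 pot1 rbP.
rewrite !add0n => wf' tb tr tp; split=> //.
rewrite /finish time_in_bind split_up_phase //.
case: (rb.2) => -[t2 q] hit; rewrite repair_phase // !addn0.
rewrite -mulnA; rewrite -mul2n -mulnA in tms.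
have : W <= W * (H - size (climbed tm t).2).+1 by rewrite leq_pmulr.
move: tms tm1; clear; lia.
Qed.

Lemma slot_lt tm y : has_time tm y -> slot tm y < size (ents y).
Proof.
rewrite /has_time /slot; elim: (ents y) => //= x s IHs.
by rewrite inE => /predU1P[->|/IHs]; rewrite ?Order.POrderTheory.lexx //; case: ifP.
Qed.

(** In [5 * W], two parts are the search, two the work at the evicted slot and the leaf, and one the
    walk down to the substitute; insertion shares the constant. *)
Lemma evict_spec H tm t : wf H t ->
  let r := evict op mu pick tm t in let k := H - size (climbed tm t).2 in
  [/\ exists H', wf H' r.2,
      k < time_in Search r <= 5 * W * k.+1,
      time_in Rebalance r <= K * H.+2,
      time_in Repair r <= K.*2 * (k + time_in Rebalance r).+1
    & time_in Rebalance r + K * pot r.2 <= K * pot t + 4 * K].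
Proof.
move=> wft; have [scp vp stop tms] := search_spec tm wft.
have [vc spc _] := climbed_spec tm wft.
cbv zeta; rewrite /evict; set p := (search tm t).2 in scp vp stop *.
rewrite ![time_in _ (bind (search tm t) _)]time_in_bind.
rewrite [(bind (search tm t) _).2]bind_res -/p.
rewrite !(@search_phase Rebalance) // !(@search_phase Repair) //.
case: ifP => ht; last first.
  rewrite !time_in_ret !addn0 add0n /=; split=> //; last exact: leq_addr.
    by exists H.
  rewrite -mulnA; rewrite -mul2n -mulnA in tms.
  by move: tms; clear; lia.
have [] := evict_at_spec wft vp (slot_lt ht).
set m := evict_at _ _ _ _ => vl spl.
rewrite ![time_in _ (bind m _)]time_in_bind [(bind m _).2]bind_res.
have [m1 m2] : time_in Rebalance m = 0 /\ time_in Repair m = 0.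
  by rewrite !evict_at_phase.
rewrite m1 m2; move: (time_in Search m) vl spl {m1 m2} => TS.
case: (m.2) => t1 l /= vl spl [[ctx1 anc1] un1 ar1 pot1] tm1.
set rb := merge_up _ _ _ _ _ _; rewrite -/(finish p rb).
have rbP : rebalanced (H - size l) l t1 rb by apply: merge_up_spec.
have [] := finish_spec wft vl scp spl spc anc1 _ rbP; first by slia.
rewrite !add0n => wf' tb tr tp; split=> //.
rewrite /finish time_in_bind merge_up_phase //.
case: (rb.2) => -[t2 q] hit; rewrite repair_phase // !addn0.
rewrite -mulnA; rewrite -mul2n -mulnA in tms.
have le_cp : size (climbed tm t).2 <= size p := size_suffix scp.
have : 12 * (H - size (climbed tm t).2).+1 <= W * (H - size (climbed tm t).2).+1.
  by rewrite leq_mul2r W_ge orbT.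
have : W <= W * (H - size (climbed tm t).2).+1 by rewrite leq_pmulr.
move: tms tm1 le_cp; clear; lia.
Qed.


(** * Distance to the ends of the window *)

Lemma left_leaf y : let p := nseq (height y) 0 in
  valid y p && is_leaf (node_at y p).
Proof.
elim/tree_nested_ind: y => a es [|z zs] // /(_ 0 isT) IHz; cbv zeta.
have -> : nseq (height (Node a es (z :: zs))) 0 = nseq (height z) 0 ++ [:: 0].
  by rewrite -[[:: 0]]/(nseq 1 0) -nseqD addn1.
by rewrite valid_cat node_at_cat; move: IHz => /= /andP[-> ->].
Qed.

(** The leftmost leaf below [p] and the leftmost leaf of [t] have the same depth. *)
Lemma node_height t p : finger_btree op mu t -> valid t p ->
  size p + height (node_at t p) = height t.
Proof.
move=> fb vp; have /andP[v1 l1] := left_leaf (node_at t p).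
have /andP[v2 l2] := left_leaf t.
have := leaf_depth fb (p := nseq (height (node_at t p)) 0 ++ p) _ v2 _ l2.
by rewrite valid_cat node_at_cat vp v1 l1 size_cat !size_nseq addnC; apply.
Qed.

(** Turns conditions on all addresses into the recursive invariant, by induction on the height of
    the node at [p]; [node_height] makes the height of a child one less than that of its parent. *)
Lemma finger_btree_wf t : finger_btree op mu t -> wf (height t) t.
Proof.
move=> fb; rewrite /wf /goodp; apply/andP; split.
  case: (root_arity fb) => [|[es0 zs0]]; first by rewrite /min_arity; slia.
  by rewrite /arity es0; case: (t) zs0 => a es zs /= ->; rewrite /min_arity /=; lia.
suff: forall h p, valid t p -> height (node_at t p) = h ->
    uniform h (node_at t p) by move/(_ _ [::] isT erefl).
elim=> [|h IHh] p vp.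
  by rewrite uniform0; case: (node_at t p) => a es [].
move=> hp; have nlf : ~~ is_leaf (node_at t p).
  by move: hp; rewrite /is_leaf; case: (node_at t p) => a es [].
rewrite uniformS (node_kids fb vp nlf) eqxx /=.
apply/(all_nthP empty) => i ip; have vi : valid t (i :: p) by rewrite /= vp.
rewrite /good /goodp (node_arity fb vi) //; apply: (IHh (i :: p)) => //.
by have := node_height fb vi; have := node_height fb vp; rewrite hp /=; slia.
Qed.

(** * Lower bounds on the number of entries of a subtree *)

Lemma entriesE y : entries y = weave (map (@entries disp T S) (kids y)) (ents y).
Proof. by case: y. Qed.

Lemma count_weave A (P : pred A) zs xs i : i < size zs ->
  size zs <= (size xs).+1 -> count P (nth [::] zs i) <= count P (weave zs xs).
Proof.
elim: zs xs i => [|z zs IHzs] [|x xs] [|i] //=; rewrite ?ltnS.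
- by case: zs {IHzs}.
- by move=> _ _; rewrite count_cat leq_addr.
move=> lti szs; rewrite count_cat /=; apply: leq_trans (IHzs xs i lti szs) _.
by rewrite addnA leq_addl.
Qed.

Lemma count_kid P y i : size (kids y) = arity y -> i < size (kids y) ->
  count P (entries (nth empty (kids y) i)) <= count P (entries y).
Proof.
move=> sz iy; rewrite [entries y]entriesE -(nth_map _ [::]) //.
by apply: count_weave; rewrite size_map // sz.
Qed.

Lemma count_node_at P H t p : wf H t -> valid t p ->
  count P (entries (node_at t p)) <= count P (entries t).
Proof.
move=> wft; elim: p => //= i p IHp /andP[vp ip].
apply: leq_trans (IHp vp); apply: count_kid => //; apply: (wf_kids wft) => //.
by rewrite /is_leaf /nilp; slia.
Qed.

(** Since [2 <= mu], every inner node has two children, and these alone double the count; base 2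
    thus works for every [mu]. *)
Lemma size_entries h y : good h y -> 2 ^ h <= size (entries y).
Proof.
elim: h y => [|h IHh] [a es zs] /andP[/andP[ar _]].
  by rewrite uniform0 /min_arity /arity /= in ar * => /nilP-> /=; slia.
rewrite uniformS /min_arity /arity /= in ar * => /andP[/eqP].
case: es zs ar => [|x es] [|z1 [|z2 zs]] //=; first by slia.
move=> _ [szs] /and3P[/IHh g1 /IHh g2 _]; rewrite size_cat /= expnS mul2n -addnn.
apply: leq_add => //; apply: leqW; apply: leq_trans g2 _.
have := @count_weave _ predT (entries z2 :: map (@entries disp T S) zs) es 0.
by rewrite !count_predT /=; apply; rewrite ?size_map ?szs.
Qed.

Lemma trunc_log_bound k d : (0 < k -> 2 ^ k.-1 <= d) -> k <= (trunc_log 2 d).+1.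
Proof. by case: k => // k /(_ isT) /= kd; rewrite ltnS trunc_log_max. Qed.

Lemma height_bound H t : wf H t -> H <= (trunc_log 2 (window_size t)).+1.
Proof.
move=> wft; apply: trunc_log_bound => H_gt0.
have nlf : ~~ is_leaf (node_at t [::]) by rewrite (wf_leaf wft) //=; lia.
have sz : size (kids t) = arity t by apply: (wf_kids (p := [::]) wft).
have v0 : valid t [:: 0] by rewrite /= sz.
have [_ g0] := wf_node_at wft v0; rewrite /= subn1 in g0.
apply: leq_trans (size_entries g0) _.
by have := count_node_at predT wft v0; rewrite !count_predT.
Qed.

Section Distance.

Variable t : tree T S.
Hypothesis fb : finger_btree op mu t.
Let wft := finger_btree_wf fb.
Let H := height t.

Lemma subtree_count (P : pred T) p : valid t p -> ~~ nilp p ->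
  (forall x, x \in times (node_at t p) -> P x) ->
  2 ^ (H - size p) <= count (fun x => P x.1) (entries t).
Proof.
move=> vp np subP; have [_ gp] := wf_node_at wft vp; rewrite (negbTE np) in gp.
apply: leq_trans (size_entries gp) _; apply: leq_trans (count_node_at _ wft vp).
have /eqP <- : count P (times (node_at t p)) == size (entries (node_at t p)).
  by rewrite -(size_map fst) -all_count; apply/allP => x /subP.
by rewrite count_map.
Qed.

Variables (tm : T) (p : addr).
Hypotheses (vp : valid t p) (nlf : ~~ is_leaf (node_at t p)).
Let y := node_at t p.
Let ts := [seq x.1 | x <- ents y].
Let n := (size (ents y)).-1.

Lemma inner_ents : size (kids y) = n.+2 /\ size ts = n.+1.
Proof.
have sz := wf_kids wft vp nlf.
have [_ /andP[/andP[ar _] un]] := wf_node_at wft vp.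
have : 2 <= arity y.
  apply: leq_trans ar; rewrite /min_arity; case: nilp => //.
  by have := wf_leaf wft vp; have := wf_valid_size wft vp; move: nlf; lia.
by rewrite /ts size_map /n; move: sz; rewrite -/y /arity; slia.
Qed.

Lemma afterE : after tm y = (nth tm ts n < tm)%O.
Proof.
have [_] := inner_ents; rewrite /n /ts /after size_map.
case: (ents y) => // x s _.
by rewrite (nth_map x) // [in RHS]/= -last_nth.
Qed.

Lemma beforeE : before tm y = (tm < nth tm ts 0)%O.
Proof.
have [_] := inner_ents; rewrite /ts /before size_map.
by case: (ents y).
Qed.

(** Child [i.+1] lies to the right of entry [i], so all of its entries come after [tm]. *)
Lemma kid_above i : i <= n -> (tm <= nth tm ts i)%O ->
  2 ^ (H - (size p).+1) <= count (fun x => tm < x.1)%O (entries t).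
Proof.
have [szk szt] := inner_ents; move=> lei tmi.
have vi : valid t (i.+1 :: p) by rewrite /= vp -/y szk.
apply: (@subtree_count (fun x => tm < x)%O _ vi) => // x xi.
have [/(_ isT) + _] := kids_between fb vi xi; rewrite -/y -/ts /=.
(* [kids_between] reads the entries with [x] as default value; within bounds it may be replaced by
   [tm]. *)
rewrite (set_nth_default tm) ?szt //; exact: Order.POrderTheory.le_lt_trans.
Qed.

Lemma kid_below i : i <= n -> (nth tm ts i <= tm)%O ->
  2 ^ (H - (size p).+1) <= count (fun x => x.1 < tm)%O (entries t).
Proof.
have [szk szt] := inner_ents; move=> lei tmi.
have vi : valid t (i :: p) by rewrite /= vp -/y szk ltnS leqW.
apply: (@subtree_count (fun x => x < tm)%O _ vi) => // x xi.
have [_] := kids_between fb vi xi; rewrite -/y -/ts szt ltnS => /(_ lei).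
rewrite (set_nth_default tm) ?szt // => xt; exact: Order.POrderTheory.lt_le_trans tmi.
Qed.

End Distance.

Lemma climbed_distance tm t : finger_btree op mu t ->
  height t - size (climbed tm t).2 <= (trunc_log 2 (distance tm t)).+1.
Proof.
move=> fb; have wft := finger_btree_wf fb; set H := height t in wft *.
apply: trunc_log_bound => k_gt0.
have vt : valid t [::] by [].
have nlft : ~~ is_leaf (node_at t [::]) by rewrite (wf_leaf wft) //=; slia.
(* A positive number of levels means that the climb has left its finger, so its test failed at
   [c]. *)
have stop cov f : valid t f -> size f = H -> let c := (climb cov t f).2 in
    0 < H - size c ->
    [/\ valid t c, ~~ is_leaf (node_at t c) & ~~ cov (node_at t c)].
  move=> vf szf c kc; have [sc nc _] := climb_spec cov t f.
  have vc := valid_suffix sc vf.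
  have [|i _ ncov] := nc; last split=> //.
    by apply: contraTneq kc => cf; rewrite /c cf szf subnn.
  by rewrite (wf_leaf wft) // -/c; slia.
(* A child of the root is at least as high as a child of [c], so it suffices for the other end of
   the window. *)
have le1 (c : addr) : 2 ^ (H - (size c).+1) <= 2 ^ (H - (size (Nil nat)).+1).
  by rewrite leq_exp2l //=; slia.
rewrite -subnS /distance leq_min; move: k_gt0; rewrite /climbed.
case: ifP => [aft|/negbT naft] k_gt0.
  have [vr szr _] := right_finger_spec wft.
  have [vc nlfc] := stop (after tm) _ vr szr k_gt0.
  rewrite (afterE fb) // -Order.TotalTheory.leNgt => tm_le.
  apply/andP; split; last exact: (kid_above fb vc nlfc (leqnn _) tm_le).
  apply: leq_trans (le1 _) _.
  apply: (kid_below fb vt nlft (leqnn _)); apply: Order.POrderTheory.ltW.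
  by rewrite -(afterE fb).
(* This case includes times between entries of the root: the last child of the root is beyond [tm]
   whenever [after] fails there. *)
have [vl szl _] := left_finger_spec wft.
have [vc nlfc] := stop (before tm) _ vl szl k_gt0.
rewrite (beforeE fb) // -Order.TotalTheory.leNgt => tm_ge.
apply/andP; split; first exact: (kid_below fb vc nlfc (leq0n _) tm_ge).
apply: leq_trans (le1 _) _; apply: (kid_above fb vt nlft (leqnn _)).
by rewrite Order.TotalTheory.leNgt -(afterE fb).
Qed.

(** * The query phase, and sequences of updates *)

Lemma insert_query tm v t : time_in Query (insert op mu tm v t) = 0.
Proof.
rewrite /insert time_in_bind search_phase // time_in_bind insert_at_phase //.
rewrite time_in_bind split_up_phase //.
by case: (_.2) => -[t2 q] hit; rewrite repair_phase.
Qed.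

Lemma evict_query tm t : time_in Query (evict op mu pick tm t) = 0.
Proof.
rewrite /evict time_in_bind search_phase //; case: ifP => _ //.
rewrite time_in_bind evict_at_phase //; case: (_.2) => t1 l.
rewrite time_in_bind merge_up_phase //.
by case: (_.2) => -[t2 q] hit; rewrite repair_phase.
Qed.

(** The amortized inequalities telescope. The height varies along the sequence, hence the generality
    in [H]. *)
Lemma apply_updates_rebalance H us t : wf H t ->
  time_in Rebalance (apply_updates op mu pick us t) <=
  K * pot t + 4 * K * size us.
Proof.
elim: us H t => [|u us IHus] H t wft //=.
have [[H' wf'] tmu] : (exists H', wf H' (apply_update op mu pick u t).2) /\
    time_in Rebalance (apply_update op mu pick u t)
    + K * pot (apply_update op mu pick u t).2 <= K * pot t + 4 * K.
  by case: u => [tm v|tm]; [case: (insert_spec tm v wft) | case: (evict_spec tm wft)].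
rewrite time_in_bind mulnS; have := IHus _ _ wf'.
by move: tmu; move: (apply_update op mu pick u t) => r; clear; lia.
Qed.

End Shape.

Theorem theorem3p4 (mu : nat) (mu_ge2 : 2 <= mu) :
  exists C : nat,
  forall (disp : Order.disp_t) (T : orderType disp) (S : Type) (e : S)
         (op : Monoid.law e) (pick : tree T S -> nat -> bool),
  [/\ (forall t : tree T S, finger_btree op mu t -> time (query op t) <= C),
      (forall (t : tree T S) (tm : T) (v : S), finger_btree op mu t ->
         let r := insert op mu tm v t in
         [/\ time r = time_in Search r + time_in Rebalance r + time_in Repair r,
             time_in Search r <= C * (trunc_log 2 (distance tm t)).+1,
             time_in Rebalance r <= C * (trunc_log 2 (window_size t)).+1 &
             time_in Repair r <= C * (time_in Search r + time_in Rebalance r)]),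
      (forall (t : tree T S) (tm : T), finger_btree op mu t ->
         let r := evict op mu pick tm t in
         [/\ time r = time_in Search r + time_in Rebalance r + time_in Repair r,
             time_in Search r <= C * (trunc_log 2 (distance tm t)).+1,
             time_in Rebalance r <= C * (trunc_log 2 (window_size t)).+1 &
             time_in Repair r <= C * (time_in Search r + time_in Rebalance r)]) &
      (forall us : seq (update T S),
         time_in Rebalance (apply_updates op mu pick us (empty (e := e)))
           <= C * size us)].
Proof.
exists (7 * K mu) => disp T S e op pick.
have W_ge12 : 12 <= W mu by apply: W_ge.
have K_ge : 48 <= K mu by rewrite /K; lia.
(* [7 * K mu] is dictated by the amortized bound below. In the repair bound the strict [k < s]
   absorbs the successor. *)
have bounds k s b rp d n h : k <= (trunc_log 2 d).+1 -> h <= (trunc_log 2 n).+1 ->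
    k < s <= 5 * W mu * k.+1 -> b <= K mu * h.+2 -> rp <= (K mu).*2 * (k + b).+1 ->
    [/\ s <= 7 * K mu * (trunc_log 2 d).+1, b <= 7 * K mu * (trunc_log 2 n).+1
      & rp <= 7 * K mu * (s + b)].
  move=> kd hn /andP[ks sk] bh rpb; split.
  - apply: leq_trans sk _; apply: (@leq_trans (5 * W mu * (2 * (trunc_log 2 d).+1))).
      by rewrite leq_mul2l; apply/orP; right; lia.
    by rewrite mulnA leq_mul2r; apply/orP; right; rewrite /K; lia.
  - apply: leq_trans bh _; apply: (@leq_trans (K mu * (3 * (trunc_log 2 n).+1))).
      by rewrite leq_mul2l; apply/orP; right; lia.
    by rewrite mulnA leq_mul2r; apply/orP; right; lia.
  apply: leq_trans rpb _; apply: leq_mul; first by lia.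
  by lia.
split.
- by move=> t _; rewrite /query /time /trace; case: ifP => _ /=; lia.
- move=> t tm v fb; have wft := finger_btree_wf mu_ge2 fb; cbv zeta.
  have [_ tms tb tr _] := insert_spec op mu_ge2 tm v wft.
  have [a1 a2 a3] := bounds _ _ _ _ _ _ _ (climbed_distance mu_ge2 tm fb)
    (height_bound (e := e) mu_ge2 wft) tms tb tr.
  by split=> //; apply: time_phases; apply: insert_query.
- move=> t tm fb; have wft := finger_btree_wf mu_ge2 fb; cbv zeta.
  have [_ tms tb tr _] := evict_spec op pick mu_ge2 tm wft.
  have [a1 a2 a3] := bounds _ _ _ _ _ _ _ (climbed_distance mu_ge2 tm fb)
    (height_bound (e := e) mu_ge2 wft) tms tb tr.
  by split=> //; apply: time_phases; apply: evict_query.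
case=> [//|u us]; have wf0 : wf mu 0 (empty (e := e) : tree T S).
  by rewrite /wf /goodp uniform0 andbT /min_arity /arity /=; lia.
apply: leq_trans (apply_updates_rebalance op pick mu_ge2 _ wf0) _.
(* The empty root has arity 1 and potential 3; these [3 * K mu] are charged to the first update, on
   top of [4 * K mu] for each. *)
rewrite potE /= addn0 (phi_lt (a := 1)) //.
have : K mu * 3 <= 3 * K mu * (size us).+1 by rewrite mulnC leq_pmulr.
by move: (K mu) => k; clear; lia.
Qed.
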